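(* Let $V$ be a smooth one-parameter family of vector fields near $(0,0,0)\in\mathbb{R}\times\mathbb{R}^{n-1}\times\mathbb{R}$ of the form $$\begin{cases}\dot{u}=F(u,y,\varepsilon)\\ \dot{y}=My+G(u,y,\varepsilon)\end{cases}$$ with $u\in\mathbb{R}$, $y\in\mathbb{R}^{n-1}$, $\varepsilon\in\mathbb{R}$, where all eigenvalues of the square matrix $M$ have non-zero real part and $F(0,0,0)=0$, $DF(0,0,0)=0$, $G(0,0,0)=0$, $DG(0,0,0)=0$. Write $x=(u,y)$, $x_0=(0,0)$, $\varepsilon_0=0$. Assume: (P0) $x_0$ is an isolated zero of $V(\cdot,\varepsilon_0)$, it is simple non-hyperbolic, and its index as a zero of $V(\cdot,\varepsilon_0)$ is non-zero; (P1) $\frac{\partial V}{\partial\varepsilon}(x_0,\varepsilon_0)\in \operatorname{image}(D_xV(x_0,\varepsilon_0))$; (P2) there exists $\omega=(\omega_1,\dots,\omega_{n+1})^{\top}\in\mathbb{R}^{n+1}$ such that $DV(x_0,\varepsilon_0)\,\omega=0$, $\omega_{n+1}\neq 0$, and $D(\det(D_xV))(x_0,\varepsilon_0)\,\omega\neq 0$; (P3) $D_{uu}\det(D_xV)\big|_{(0,0,0)}-D_y(\det (D_xV))\big(M^{-1}G_{uu}\big)\big|_{(0,0,0)}\neq 0$. Then $V$ undergoes a $1\to 3$ or a $3\to 1$ bifurcation at $(x_0,\varepsilon_0)$.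
   Context: $D_xV$ is the $n\times n$ Jacobian in $x=(u,y)$; $DV$ is the full $n\times(n+1)$ derivative in $(x,\varepsilon)$; likewise $DF,DG$ are derivatives in $(u,y,\varepsilon)$; $D(\det(D_xV))$ is the derivative in $(x,\varepsilon)$ of the scalar function $\det D_xV(x,\varepsilon)$; subscripts denote partial derivatives. ''Smooth'' means $C^\infty$. $(x_0,\varepsilon_0)$ is simple non-hyperbolic if $D_xV(x_0,\varepsilon_0)$ has $0$ as a simple eigenvalue and all its other eigenvalues are off the imaginary axis. The index of an isolated zero $z$ of a vector field $W$ on $\mathbb{R}^n$ is the degree of $W/|W|:\partial D\to S^{n-1}$, where $D$ is a closed disk centred at $z$ containing no other zero of $W$. A $1\to 3$ bifurcation at $(x_0,\varepsilon_0)$: there are a neighborhood $U$ of $x_0$ and $\delta>0$ such that $V(\cdot,\varepsilon)$ has exactly one zero in $U$ for every $\varepsilon\in(\varepsilon_0-\delta,\varepsilon_0]$ and exactly three zeros in $U$ for every $\varepsilon\in(\varepsilon_0,\varepsilon_0+\delta)$. A $3\to1$ bifurcation is the same with the direction of $\varepsilon$ reversed (exactly three zeros for $\varepsilon\in(\varepsilon_0-\delta,\varepsilon_0)$, exactly one for $\varepsilon\in[\varepsilon_0,\varepsilon_0+\delta)$). *)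

(* Defs.v *)
From HB Require Import structures.
From mathcomp Require Import all_boot all_order all_algebra.
From mathcomp Require Import all_classical all_reals topology normedtype derive.
From mathcomp Require Import complex.

Set Implicit Arguments.
Unset Strict Implicit.
Unset Printing Implicit Defensive.

Import Order.TTheory GRing.Theory Num.Theory.
Import numFieldNormedType.Exports.

Local Open Scope classical_set_scope.
Local Open Scope ring_scope.
Local Open Scope card_scope.

(* C^oo on an open set Omega of a finite-dimensional space: every iterated
   directional derivative is (Frechet) differentiable at every point of Omega. *)
Definition smooth_on (R : realType) (E E' : normedModType R)
    (Omega : set E) (f : E -> E') : Prop :=
  forall (vs : seq E) (z : E), Omega z ->
    differentiable (foldr (fun v g => 'D_v g) f vs) z.

(* The usual Jacobian acting on column vectors; the library's [jacobian] is for
   row vectors and is the transpose of this one. *)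
Definition jacobian_mx (R : realType) (n : nat)
    (W : 'cV[R]_n -> 'cV[R]_n) (x : 'cV[R]_n) : 'M[R]_n :=
  \matrix_(i, j) ('D_(delta_mx j 0) W x) i 0.

Definition complexify (R : realType) (n : nat) (A : 'M[R]_n) : 'M[complex R]_n :=
  map_mx (real_complex R) A.

Definition hyperbolic_mx (R : realType) (n : nat) (A : 'M[R]_n) : Prop :=
  forall l : complex R, eigenvalue (complexify A) l -> complex.Re l <> 0.

Definition simple_nonhyperbolic_mx (R : realType) (n : nat) (A : 'M[R]_n) : Prop :=
  mup 0 (char_poly (complexify A)) = 1%N /\
  forall l : complex R, eigenvalue (complexify A) l -> l <> 0 ->
    complex.Re l <> 0.

(* The norm `|x| that the library puts on matrices is the sup norm. *)
Definition enorm (R : realType) (n : nat) (x : 'cV[R]_n) : R :=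
  Num.sqrt (\sum_(i < n) x i 0 ^+ 2).

Definition normalize (R : realType) (n : nat) (W : 'cV[R]_n -> 'cV[R]_n)
    (x : 'cV[R]_n) : 'cV[R]_n :=
  (enorm (W x))^-1 *: W x.

(* Let f map the sphere S of centre z and radius r smoothly into the unit sphere
   S^(n-1), f being defined near S, and let p be on S, with outer unit normal nu.
   The matrix below is that of the linear map which sends nu to f(p) (the outer
   normal of S^(n-1) at f(p)) and agrees with the differential of f on T_p S.
   As df_p maps T_p S into the orthogonal of f(p), its determinant is that of
   df_p : T_p S -> T_(f p) S^(n-1) in positively oriented orthonormal bases,
   both spheres being oriented by their outer normals. *)
Definition sphere_jacobian (R : realType) (n : nat)
    (f : 'cV[R]_n -> 'cV[R]_n) (z p : 'cV[R]_n) : R :=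
  let nu := (enorm (p - z))^-1 *: (p - z) in
  \det (jacobian_mx f p *m (1%:M - nu *m nu^T) + f p *m nu^T).

Definition sphere_fiber (R : realType) (n : nat)
    (f : 'cV[R]_n -> 'cV[R]_n) (z : 'cV[R]_n) (r : R) (v : 'cV[R]_n) :
    set 'cV[R]_n :=
  [set p | enorm (p - z) = r /\ f p = v].

(* The degree of a smooth map f from the sphere of centre z and radius r to the
   unit sphere S^(n-1): the number of preimages of a regular value, counted with
   the sign of the differential. The count does not depend on the regular value
   (and regular values exist, by Sard), so d is the count at all of them; the
   fibre of a regular value is finite. *)
Definition sphere_degree (R : realType) (n : nat)
    (f : 'cV[R]_n -> 'cV[R]_n) (z : 'cV[R]_n) (r : R) (d : int) : Prop :=
  forall v : 'cV[R]_n, enorm v = 1 ->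
    (forall p, sphere_fiber f z r v p -> sphere_jacobian f z p <> 0) ->
    \sum_(p \in sphere_fiber f z r v) sgz (sphere_jacobian f z p) = d.

Definition isolated_zero (R : realType) (n : nat)
    (W : 'cV[R]_n -> 'cV[R]_n) (z : 'cV[R]_n) : Prop :=
  W z = 0 /\ \forall x \near z, W x = 0 -> x = z.

(* d is the index of the isolated zero z of the smooth vector field W, defined on
   the open set A. The degree is the same for all the admissible disks D. *)
Definition index_of_zero (R : realType) (n : nat) (A : set 'cV[R]_n)
    (W : 'cV[R]_n -> 'cV[R]_n) (z : 'cV[R]_n) (d : int) : Prop :=
  isolated_zero W z /\
  forall r : R, 0 < r ->
    (forall x, enorm (x - z) <= r -> A x /\ (W x = 0 -> x = z)) ->
    sphere_degree (normalize W) z r d.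

(* A one-parameter family on R^n is a map V : 'cV_n * R -> 'cV_n, of which only
   the restriction to an open set Omega of 'cV_n * R is meaningful. *)

Definition DxV (R : realType) (n : nat) (V : 'cV[R]_n * R -> 'cV[R]_n)
    (z : 'cV[R]_n * R) : 'M[R]_n :=
  jacobian_mx (fun x => V (x, z.2)) z.1.

Definition detDxV (R : realType) (n : nat) (V : 'cV[R]_n * R -> 'cV[R]_n)
    (z : 'cV[R]_n * R) : R :=
  \det (DxV V z).

Definition propertyP0 (R : realType) (n : nat) (Omega : set ('cV[R]_n * R))
    (V : 'cV[R]_n * R -> 'cV[R]_n) (x0 : 'cV[R]_n) (eps0 : R) : Prop :=
  [/\ isolated_zero (fun x => V (x, eps0)) x0,
      simple_nonhyperbolic_mx (DxV V (x0, eps0))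
    & exists2 d : int,
        index_of_zero [set x | Omega (x, eps0)] (fun x => V (x, eps0)) x0 d
        & d <> 0].

Definition propertyP1 (R : realType) (n : nat)
    (V : 'cV[R]_n * R -> 'cV[R]_n) (x0 : 'cV[R]_n) (eps0 : R) : Prop :=
  exists v : 'cV[R]_n,
    'D_((0, 1) : 'cV[R]_n * R) V (x0, eps0) = DxV V (x0, eps0) *m v.

Definition propertyP2 (R : realType) (n : nat)
    (V : 'cV[R]_n * R -> 'cV[R]_n) (x0 : 'cV[R]_n) (eps0 : R) : Prop :=
  exists w : 'cV[R]_n * R,
    [/\ 'd V (x0, eps0) w = 0,
        w.2 <> 0
      & 'd (detDxV V) (x0, eps0) w <> 0].

Definition zeros_in (R : realType) (n : nat) (V : 'cV[R]_n * R -> 'cV[R]_n)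
    (U : set 'cV[R]_n) (eps : R) : set 'cV[R]_n :=
  [set x | U x /\ V (x, eps) = 0].

Definition bifurcation_1_3 (R : realType) (n : nat) (Omega : set ('cV[R]_n * R))
    (V : 'cV[R]_n * R -> 'cV[R]_n) (x0 : 'cV[R]_n) (eps0 : R) : Prop :=
  exists (U : set 'cV[R]_n) (delta : R),
    [/\ nbhs x0 U, 0 < delta,
        forall x eps, U x -> eps0 - delta < eps < eps0 + delta -> Omega (x, eps),
        forall eps, eps0 - delta < eps <= eps0 -> zeros_in V U eps #= `I_1
      & forall eps, eps0 < eps < eps0 + delta -> zeros_in V U eps #= `I_3].

Definition bifurcation_3_1 (R : realType) (n : nat) (Omega : set ('cV[R]_n * R))
    (V : 'cV[R]_n * R -> 'cV[R]_n) (x0 : 'cV[R]_n) (eps0 : R) : Prop :=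
  exists (U : set 'cV[R]_n) (delta : R),
    [/\ nbhs x0 U, 0 < delta,
        forall x eps, U x -> eps0 - delta < eps < eps0 + delta -> Omega (x, eps),
        forall eps, eps0 - delta < eps < eps0 -> zeros_in V U eps #= `I_3
      & forall eps, eps0 <= eps < eps0 + delta -> zeros_in V U eps #= `I_1].

(* Here n = 1 + m and x = col_mx u y, with u in R and y in R^m. *)

Definition split_family (R : realType) (m : nat) (M : 'M[R]_m)
    (F : 'cV[R]_(1 + m) * R -> R) (G : 'cV[R]_(1 + m) * R -> 'cV[R]_m)
    (z : 'cV[R]_(1 + m) * R) : 'cV[R]_(1 + m) :=
  col_mx (F z)%:M (M *m dsubmx z.1 + G z).

Definition u_dir (R : realType) (m : nat) : 'cV[R]_(1 + m) * R :=
  (col_mx 1%:M 0, 0).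

Definition y_dir (R : realType) (m : nat) (v : 'cV[R]_m) :
    'cV[R]_(1 + m) * R :=
  (col_mx 0 v, 0).

Definition duu (R : realType) (m : nat) (E : normedModType R)
    (f : 'cV[R]_(1 + m) * R -> E) : 'cV[R]_(1 + m) * R -> E :=
  'D_(u_dir R m) ('D_(u_dir R m) f).

Definition propertyP3 (R : realType) (m : nat) (M : 'M[R]_m)
    (F : 'cV[R]_(1 + m) * R -> R) (G : 'cV[R]_(1 + m) * R -> 'cV[R]_m) : Prop :=
  let Delta := detDxV (split_family M F G) in
  duu Delta 0 - 'd Delta 0 (y_dir (invmx M *m duu G 0)) <> 0.

(* Main.v *)
Require Import Defs.
From HB Require Import structures.
From mathcomp Require Import all_boot all_order all_algebra.
From mathcomp Require Import all_classical all_reals topology normedtype derive.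
From mathcomp Require Import complex.
From mathcomp Require Import sequences interval_inference landau.
From mathcomp Require Import ring lra.

Set Implicit Arguments.
Unset Strict Implicit.
Unset Printing Implicit Defensive.

Import Order.TTheory GRing.Theory Num.Theory.
Import numFieldNormedType.Exports.

Local Open Scope classical_set_scope.
Local Open Scope ring_scope.

(** Near the origin the equation M y + G(u, y, e) = 0 has exactly one small
    solution y = g(u, e), because M is invertible and G has a vanishing
    differential ([implicit_branch_exists]).  The zeros of V(., e) thus
    correspond to those of the scalar function f(u, e) = F(u, g(u, e), e), and
    the theorem says that f is a perturbed pitchfork.

    Only Lipschitz estimates on g are established; the derivative of f comes
    from V itself.  Two points of the branch over the same e differ by some w
    with V(z + w) - V(z) = (df, 0), and multiplying D_xV(z) w = (df, 0) + o(w)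
    by the adjugate of D_xV(z) gives f_u = Delta / C, where Delta = det D_xV and
    C is the cofactor of the uu entry, close to det M
    ([reduced_derivative]).  This is how conditions on Delta become conditions on f_u.
    On the branch g = - (u^2 / 2) M^-1 G_uu + o(u^2 + |e|), so a Taylor
    expansion of Delta at the origin gives
      Delta = Delta_u u + Delta_e e + (u^2 / 2) beta + o(u^2 + |e|)
    where beta = Delta_uu - Delta_y M^-1 G_uu is the number that [propertyP3]
    assumes to be non-zero ([Delta_expansion]).

    The index takes care of the linear term.  If Delta_u were non-zero then
    f(u, 0) would have a strict and constant sign for u <> 0.  On a small sphere
    V would then vanish in its y component only where F has that sign, so
    V / |V| would omit one of the two points (+1, 0), (-1, 0) and the degree
    would be zero ([index_forces_Du0]).  Hence Delta_u = 0.  A vector killed by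
    DV has no y component, so [propertyP2] now says that Delta_e is non-zero
    ([transversality]).

    Thus f_u = a e + b u^2 + o(u^2 + |e|) with a and b non-zero, while
    f(0, e) = O(e^2).  Rescaling f and e turns the model into u^3 - 3 e u, with
    an error that is negligible at the scale u ~ sqrt |e| of its turning points;
    the perturbed function has one zero for e <= 0 and three for e > 0
    ([pitchfork_zeros]).  The sign of - b / a decides whether this is a
    1 -> 3 or a 3 -> 1 bifurcation. *)

(** * Perturbed pitchforks in one variable *)

Section Pitchfork.
Variable R : realType.

Lemma derive_continuous_itv (f df : R -> R) (a b : R) :
  (forall x, a <= x <= b -> is_derive x 1 f (df x)) ->
  {within `[a, b], continuous f}.
Proof.
move=> fdf; apply: derivable_within_continuous => x.
by rewrite in_itv /= => /fdf [].
Qed.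

Lemma mean_value (f df : R -> R) (a b : R) : a < b ->
  (forall x, a <= x <= b -> is_derive x 1 f (df x)) ->
  exists2 c, a < c < b & f b - f a = df c * (b - a).
Proof.
move=> ab fdf.
have [||c] := @MVT R f df a b ab.
- by move=> x; rewrite in_itv /= => /andP[/ltW ax /ltW xb]; apply: fdf; rewrite ax xb.
- exact: derive_continuous_itv fdf.
- by rewrite in_itv /= => acb ->; exists c.
Qed.

Lemma zero_of_sign_change (f df : R -> R) (a b : R) : a < b ->
  (forall x, a <= x <= b -> is_derive x 1 f (df x)) ->
  f a * f b < 0 -> exists2 c, a < c < b & f c = 0.
Proof.
move=> ab fdf fab.
have [||c] := @IVT R f a b 0 (ltW ab).
- exact: derive_continuous_itv fdf.
- have [fa|fa] := ltP (f a) 0.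
    by move: fab; rewrite nmulr_rlt0 // => fb; rewrite ge_min le_max (ltW fa) (ltW fb) orbT.
  have {}fa : 0 < f a by rewrite lt_neqAle fa andbT eq_sym; apply: contraTneq fab => ->;
      rewrite mul0r ltxx.
  by move: fab; rewrite pmulr_rlt0 // => fb; rewrite ge_min le_max (ltW fa) (ltW fb) orbT.
- rewrite in_itv /= => /andP[ac cb] fc; exists c => //.
  rewrite !lt_neqAle ac cb !andbT; apply/andP; split; apply/eqP => e.
    by move: fab; rewrite e fc mul0r ltxx.
  by move: fab; rewrite -e fc mulr0 ltxx.
Qed.

Lemma normr_le_itv (x c : R) : `|x| <= c -> - c <= x <= c.
Proof. by rewrite ler_norml. Qed.

(** The hypothesis on f 0 is the only information about values of f: everything
    else is recovered by integrating the error made on the derivative. *)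
Lemma cubic_deviation (f df : R -> R) (e eta C u : R) : 0 <= eta ->
  (forall x : R, `|x| <= `|u| -> is_derive x 1 f (df x)) ->
  (forall x : R, `|x| <= `|u| -> `|df x - 3 * (x ^+ 2 - e)| <= eta * (x ^+ 2 + `|e|)) ->
  `|f 0| <= C * e ^+ 2 ->
  `|f u - (u ^+ 3 - 3 * e * u)| <= C * e ^+ 2 + eta * (u ^+ 2 + `|e|) * `|u|.
Proof.
move=> eta0 fdf dfe f0.
pose h x := f x - (x ^+ 3 - 3 * e * x).
have hdh (x : R) : `|x| <= `|u| -> is_derive x 1 h (df x - 3 * (x ^+ 2 - e)).
  move=> /fdf fx; rewrite /h; apply: is_derive_eq.
  by rewrite /GRing.scale /=; ring.
have step a b : a < b -> `|a| <= `|u| -> `|b| <= `|u| ->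
    `|h b - h a| <= eta * (u ^+ 2 + `|e|) * (b - a).
  move=> ab /normr_le_itv/andP[a1 a2] /normr_le_itv/andP[b1 b2].
  have inu x : a <= x <= b -> `|x| <= `|u|.
    by move=> /andP[ax xb]; rewrite ler_norml (le_trans a1 ax) (le_trans xb b2).
  have [x /inu xu|c /andP[/ltW ac /ltW cb] ->] :=
      @mean_value h (fun x => df x - 3 * (x ^+ 2 - e)) a b ab.
    exact: hdh.
  rewrite normrM (@ger0_norm _ (b - a)) ?subr_ge0 ?(ltW ab)// ler_wpM2r ?subr_ge0 ?(ltW ab)//.
  have cu : `|c| <= `|u| by rewrite inu // ac cb.
  apply: le_trans (dfe c cu) _; rewrite ler_wpM2l // lerD2r.
  by rewrite -(real_normK (num_real c)) -(real_normK (num_real u)) lerXn2r ?nnegrE.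
have h0 : h 0 = f 0 by rewrite /h expr0n /= mulr0 !subr0.
have -> : f u - (u ^+ 3 - 3 * e * u) = h 0 + (h u - h 0) by rewrite -[LHS]/(h u); ring.
apply: le_trans (ler_normD _ _) _; rewrite h0; apply: lerD => //.
rewrite -h0; case: (ltgtP 0 u) => [u0|u0|<-].
- by have := step _ _ u0; rewrite normr0 subr0 => /(_ (normr_ge0 _) (lexx _));
    rewrite (gtr0_norm u0).
- have := step _ _ u0; rewrite normr0 sub0r => /(_ (lexx _) (normr_ge0 _)).
  by rewrite distrC -(ltr0_norm u0).
- by rewrite subrr normr0 mulr0.
Qed.

Definition zero_list (f : R -> R) (K : R) (s : seq R) :=
  uniq s /\ forall u, (`|u| < K /\ f u = 0) <-> u \in s.

(** For e <= 0 the model slope 3 (u^2 - e) is positive away from u = e = 0 and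
    survives the perturbation, so f is injective, except that at e = 0 the slope
    may vanish at the origin.  There the cubic estimate on f itself separates 0
    from the other points.  The condition on C makes the error on f negligible
    at u = K and u = - K. *)
Lemma pitchfork_one_zero (f df : R -> R) (e C K : R) :
  0 < K -> e <= 0 ->
  (forall x : R, `|x| <= K -> is_derive x 1 f (df x)) ->
  (forall x : R, `|x| <= K ->
     `|df x - 3 * (x ^+ 2 - e)| <= 100^-1 * (x ^+ 2 + `|e|)) ->
  `|f 0| <= C * e ^+ 2 -> C * e ^+ 2 <= K * `|e| ->
  exists2 s, zero_list f K s & size s = 1%N.
Proof.
have eta0 : 0 < 100^-1 :> R by rewrite invr_gt0 ltr0n.
move=> K0 e0 fd fde f0 Ce.
have eE : `|e| = - e by rewrite ler0_norm.
have dev (u : R) : `|u| <= K -> `|f u - (u ^+ 3 - 3 * e * u)| <=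
     C * e ^+ 2 + 100^-1 * (u ^+ 2 + `|e|) * `|u|.
  move=> uK; apply: (@cubic_deviation f df) => [|x xu|x xu|//].
  + exact: ltW.
  + by apply: fd; lra.
  + by apply: fde; lra.
have K3 : 0 < K ^+ 3 by rewrite exprn_gt0.
have Ke : 0 <= K * - e by apply: mulr_ge0; lra.
have fK : 0 < f K.
  have := dev K; rewrite (gtr0_norm K0) => /(_ (lexx _)) /normr_le_itv /andP[h _].
  move: h Ce; rewrite eE => h Ce.
  have : 100^-1 * (K ^+ 2 - e) * K = 100^-1 * K ^+ 3 + 100^-1 * (K * - e) by ring.
  lra.
have fNK : f (- K) < 0.
  have := dev (- K); rewrite normrN (gtr0_norm K0) => /(_ (lexx _)) /normr_le_itv /andP[_ h].
  move: h Ce; rewrite eE => h Ce.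
  have : 100^-1 * ((- K) ^+ 2 - e) * K = 100^-1 * K ^+ 3 + 100^-1 * (K * - e) by ring.
  have : (- K) ^+ 3 = - K ^+ 3 by ring.
  lra.
have [|||c cK fc] := @zero_of_sign_change f df (- K) K.
+ lra.
+ by move=> x xK; apply: fd; rewrite ler_norml.
+ by rewrite nmulr_rlt0.
have inj (u v : R) : `|u| < K -> `|v| < K -> f u = 0 -> f v = 0 -> u < v -> False.
  rewrite !ltr_norml => /andP[u1 u2] /andP[v1 v2] fu fv uv.
  have [x /andP[ux xv]|x /andP[ux xv]] := @mean_value f df u v uv.
    by apply: fd; rewrite ler_norml; apply/andP; split; lra.
  rewrite fu fv subrr => /esym/eqP; rewrite mulf_eq0 subr_eq0 (gt_eqF uv) orbF => /eqP d0.
  have xK : `|x| <= K by rewrite ler_norml; apply/andP; split; lra.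
  have := fde x xK; rewrite d0 eE => /normr_le_itv /andP[h _].
  have x2 := sqr_ge0 x.
  have e00 : e = 0 by lra.
  have fz (w : R) : `|w| < K -> f w = 0 -> w = 0.
    move=> /ltW wK fw; have := dev w wK.
    rewrite fw e00 expr0n normr0 !mulr0 mul0r subr0 addr0 !add0r normrN normrX.
    rewrite -(real_normK (num_real w)) => h'.
    apply/eqP; rewrite -normr_eq0; apply/eqP.
    case: (ltgtP `|w| 0) => // [|w0]; first by rewrite ltNge normr_ge0.
    have w3 : 0 < `|w| ^+ 3 by rewrite exprn_gt0.
    have : 100^-1 * `|w| ^+ 2 * `|w| = 100^-1 * `|w| ^+ 3 by ring.
    lra.
  have u0 : u = 0 by apply: fz => //; rewrite ltr_norml u1.
  have v0 : v = 0 by apply: fz => //; rewrite ltr_norml v1.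
  by move: uv; rewrite u0 v0 ltxx.
exists [:: c] => //; split => // u; rewrite inE; split.
  move=> [uK fu]; apply/eqP; case: (ltgtP u c) => // uc.
    by exfalso; apply: (inj u c) => //; rewrite ltr_norml.
  by exfalso; apply: (inj c u) => //; rewrite ltr_norml.
by move=> /eqP ->; rewrite ltr_norml.
Qed.

Lemma injective_of_critical_free (f df : R -> R) (a b : R) :
  (forall x, a <= x <= b -> is_derive x 1 f (df x)) ->
  (forall x, a <= x <= b -> df x != 0) ->
  forall u v, a <= u <= b -> a <= v <= b -> f u = f v -> u = v.
Proof.
move=> fdf dfn u v; wlog uv : u v / u < v.
  move=> H uab vab fuv; case: (ltgtP u v) => // uv; first exact: H.
  by apply/esym; apply: H.
move=> /andP[u1 u2] /andP[v1 v2] fuv.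
have sub x : u <= x <= v -> a <= x <= b.
  by move=> /andP[ux xv]; rewrite (le_trans u1 ux) (le_trans xv v2).
have [x /sub /fdf //|x /andP[/ltW ux /ltW xv]] := @mean_value f df u v uv.
rewrite fuv subrr => /esym/eqP; rewrite mulf_eq0 subr_eq0 (gt_eqF uv) orbF.
by rewrite (negPf (dfn _ (sub x _))) // ux xv.
Qed.

Lemma zero_list_three (f : R -> R) (K a1 a2 a3 a4 : R) :
  - K < a1 -> a1 < a2 -> a2 < a3 -> a3 < a4 -> a4 < K ->
  (exists2 c, - K < c < a1 & f c = 0) ->
  (exists2 c, a2 < c < a3 & f c = 0) ->
  (exists2 c, a4 < c < K & f c = 0) ->
  (forall u v, - K <= u <= a1 -> - K <= v <= a1 -> f u = f v -> u = v) ->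
  (forall u v, a2 <= u <= a3 -> a2 <= v <= a3 -> f u = f v -> u = v) ->
  (forall u v, a4 <= u <= K -> a4 <= v <= K -> f u = f v -> u = v) ->
  (forall u, a1 <= u <= a2 -> f u != 0) ->
  (forall u, a3 <= u <= a4 -> f u != 0) ->
  exists2 s, zero_list f K s & size s = 3%N.
Proof.
move=> Ka1 a12 a23 a34 a4K [c1 /andP[c1a c1b] fc1] [c2 /andP[c2a c2b] fc2].
move=> [c3 /andP[c3a c3b] fc3] i1 i2 i3 n1 n2.
exists [:: c1; c2; c3] => //; split.
  rewrite /= !inE negb_or !andbT; apply/andP; split; [apply/andP; split|];
    by apply/eqP => ?; lra.
move=> u; rewrite !inE; split; last first.
  by case/or3P => /eqP ->; split => //; rewrite ltr_norml; apply/andP; split; lra.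
rewrite ltr_norml => -[/andP[uK1 uK2] fu].
have [u1|u1] := ltP u a1.
  by apply/orP; left; apply/eqP; apply: i1; rewrite ?fu ?fc1 //;
    apply/andP; split; lra.
have [u2|u2] := leP u a2.
  by have := n1 u; rewrite u1 u2 fu eqxx => /(_ isT).
have [u3|u3] := ltP u a3.
  by apply/orP; right; apply/orP; left; apply/eqP; apply: i2; rewrite ?fu ?fc2 //;
    apply/andP; split; lra.
have [u4|u4] := leP u a4.
  by have := n2 u; rewrite u3 u4 fu eqxx => /(_ isT).
by apply/orP; right; apply/orP; right; apply/eqP; apply: i3; rewrite ?fu ?fc3 //;
  apply/andP; split; lra.
Qed.

(** The factor 3 r / 2 - u shows that the maximum over the zone is attained at
    its right end, where the cubic is - (9 / 8) r^3. *)
Lemma cubic_middle_zone (r u : R) : 0 < r -> r / 2 <= u <= 3 * r / 2 ->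
  u ^+ 3 - 3 * r ^+ 2 * u <= - (9 / 8) * r ^+ 3.
Proof.
move=> r0 /andP[u1 u2]; rewrite -subr_ge0.
have -> : - (9 / 8) * r ^+ 3 - (u ^+ 3 - 3 * r ^+ 2 * u) =
  (3 * r / 2 - u) * ((u - r / 2) * (u + 2 * r) + r ^+ 2 / 4) by field.
apply: mulr_ge0; first lra.
by rewrite addr_ge0 ?mulr_ge0 ?sqr_ge0 ?invr_ge0 //; lra.
Qed.

Lemma pitchfork_slope_middle (r x d : R) : 0 < r -> `|x| <= r / 2 ->
  `|d - 3 * (x ^+ 2 - r ^+ 2)| <= 100^-1 * (x ^+ 2 + r ^+ 2) -> d != 0.
Proof.
move=> r0 xr /normr_le_itv /andP[_ h].
have r2 : 0 < r ^+ 2 by rewrite exprn_gt0.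
have x2 : x ^+ 2 <= r ^+ 2 / 4.
  rewrite -(real_normK (num_real x)); have -> : r ^+ 2 / 4 = (r / 2) ^+ 2 by field.
  by rewrite lerXn2r ?nnegrE //; lra.
by apply/eqP => dx; rewrite dx in h; lra.
Qed.

Lemma pitchfork_slope_outer (r x d : R) : 0 < r -> 3 * r / 2 <= `|x| ->
  `|d - 3 * (x ^+ 2 - r ^+ 2)| <= 100^-1 * (x ^+ 2 + r ^+ 2) -> d != 0.
Proof.
move=> r0 xr /normr_le_itv /andP[h _].
have r2 : 0 < r ^+ 2 by rewrite exprn_gt0.
have x2 : 9 / 4 * r ^+ 2 <= x ^+ 2.
  rewrite -(real_normK (num_real x)).
  have -> : 9 / 4 * r ^+ 2 = (3 * r / 2) ^+ 2 by field.
  by rewrite lerXn2r ?nnegrE //; lra.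
by apply/eqP => dx; rewrite dx in h; lra.
Qed.

(** With e = r^2 the zeros of the model are 0 and +- sqrt 3 r, its turning points
    +- r.  On |u| <= r / 2 and on |u| >= 3 r / 2 the slope keeps its sign, so f
    is injective there; on r / 2 <= |u| <= 3 r / 2, a zone around the turning
    point, the value of the model is so large that f cannot vanish. *)
Lemma pitchfork_three_zeros (f df : R -> R) (r K : R) :
  0 < r -> 2 * r < K ->
  (forall x : R, `|x| <= K -> is_derive x 1 f (df x)) ->
  (forall x : R, `|x| <= K ->
     `|df x - 3 * (x ^+ 2 - r ^+ 2)| <= 100^-1 * (x ^+ 2 + r ^+ 2)) ->
  `|f 0| <= 4^-1 * r ^+ 3 ->
  exists2 s, zero_list f K s & size s = 3%N.
Proof.
move=> r0 r2K fd fde f0.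
have r3 : 0 < r ^+ 3 by rewrite exprn_gt0.
have dev (u : R) : `|u| <= 2 * r ->
    `|f u - (u ^+ 3 - 3 * r ^+ 2 * u)| <= 2^-1 * r ^+ 3.
  have eta0 : 0 <= 100^-1 :> R by rewrite invr_ge0 ler0n.
  have r2n : `|r ^+ 2| = r ^+ 2 by rewrite ger0_norm // sqr_ge0.
  move=> u2.
  have dd : 4^-1 * r ^+ 3 / r ^+ 4 * (r ^+ 2) ^+ 2 = 4^-1 * r ^+ 3.
    by rewrite -exprM divfK // lt0r_neq0 // exprn_gt0.
  apply: le_trans (_ : _ <= 4^-1 * r ^+ 3 / r ^+ 4 * (r ^+ 2) ^+ 2 +
      100^-1 * (u ^+ 2 + `|r ^+ 2|) * `|u|) _.
    apply: (@cubic_deviation f df) => [//|x xu|x xu|].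
    + by apply: fd; lra.
    + by rewrite r2n; apply: fde; lra.
    + by rewrite dd.
  rewrite dd r2n.
  have h : (u ^+ 2 + r ^+ 2) * `|u| <= ((2 * r) ^+ 2 + r ^+ 2) * (2 * r).
    apply: ler_pM => //; first by rewrite addr_ge0 // sqr_ge0.
    by rewrite lerD2r -(real_normK (num_real u)) lerXn2r ?nnegrE //; lra.
  have : ((2 * r) ^+ 2 + r ^+ 2) * (2 * r) = 10 * r ^+ 3 by ring.
  by clear - h r3; rewrite -mulrA; lra.
have odd3 u : (- u) ^+ 3 - 3 * r ^+ 2 * (- u) = - (u ^+ 3 - 3 * r ^+ 2 * u) by ring.
have neg u : r / 2 <= u <= 3 * r / 2 -> f u < 0.
  move=> u12; have cu := cubic_middle_zone r0 u12; move/andP: u12 => [u1 u2].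
  have := dev u; rewrite ger0_norm; last lra.
  move=> /(_ ltac:(lra)) /normr_le_itv /andP[_ h].
  by clear - h cu r3; lra.
have pos u : r / 2 <= u <= 3 * r / 2 -> 0 < f (- u).
  move=> u12; have cu := cubic_middle_zone r0 u12; move/andP: u12 => [u1 u2].
  have := dev (- u); rewrite normrN ger0_norm; last lra.
  rewrite odd3 => /(_ ltac:(lra)) /normr_le_itv /andP[h _].
  by clear - h cu r3; lra.
have cubic2 : (2 * r) ^+ 3 - 3 * r ^+ 2 * (2 * r) = 2 * r ^+ 3 by ring.
have pos2 : 0 < f (2 * r).
  have := dev (2 * r); rewrite ger0_norm; last lra.
  rewrite cubic2 => /(_ (lexx _)) /normr_le_itv /andP[h _].
  by clear - h r3; lra.
have neg2 : f (- (2 * r)) < 0.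
  have := dev (- (2 * r)); rewrite normrN ger0_norm; last lra.
  rewrite odd3 cubic2 => /(_ (lexx _)) /normr_le_itv /andP[_ h].
  by clear - h r3; lra.
have neg32 : f (3 * r / 2) < 0 by clear - neg r0; apply: neg; apply/andP; split; lra.
have neg12 : f (r / 2) < 0 by clear - neg r0; apply: neg; apply/andP; split; lra.
have pos32 : 0 < f (- (3 * r / 2)) by clear - pos r0; apply: pos; apply/andP; split; lra.
have pos12 : 0 < f (- (r / 2)) by clear - pos r0; apply: pos; apply/andP; split; lra.
clear dev f0 r3 odd3 cubic2.
have fd' a b : - K <= a -> b <= K -> forall x, a <= x <= b -> is_derive x 1 f (df x).
  clear - fd => aK bK x /andP[ax xb].
  by apply: fd; rewrite ler_norml; apply/andP; split; lra.
have zero a b : a < b -> - K <= a -> b <= K -> f a * f b < 0 ->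
    exists2 c, a < c < b & f c = 0.
  by move=> ab aK bK; apply: (@zero_of_sign_change f df) => //; apply: fd'.
have inj a b : - K <= a -> b <= K -> (forall x, a <= x <= b -> df x != 0) ->
    forall u v, a <= u <= b -> a <= v <= b -> f u = f v -> u = v.
  by move=> aK bK; apply: injective_of_critical_free; apply: fd'.
apply: (@zero_list_three f K (- (3 * r / 2)) (- (r / 2)) (r / 2) (3 * r / 2)).
- by clear - r0 r2K; lra.
- by clear - r0 r2K; lra.
- by clear - r0 r2K; lra.
- by clear - r0 r2K; lra.
- by clear - r0 r2K; lra.
- have [||||c /andP[c1 c2] fc] := zero (- (2 * r)) (- (3 * r / 2)).
  + by clear - r0 r2K; lra.
  + by clear - r0 r2K; lra.
  + by clear - r0 r2K; lra.
  + by rewrite nmulr_rlt0.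
  + by exists c => //; clear - c1 c2 r2K; apply/andP; split; lra.
- apply: zero; [| | |by rewrite pmulr_rlt0]; clear - r0 r2K; lra.
- have [||||c /andP[c1 c2] fc] := zero (3 * r / 2) (2 * r).
  + by clear - r0 r2K; lra.
  + by clear - r0 r2K; lra.
  + by clear - r0 r2K; lra.
  + by rewrite nmulr_rlt0.
  + by exists c => //; clear - c1 c2 r2K; apply/andP; split; lra.
- apply: inj; [by clear - r0 r2K; lra..|].
  move=> x /andP[x1 x2]; apply: (pitchfork_slope_outer r0 _ (fde x _)).
  + by clear - x1 x2 r0; rewrite ler0_norm; lra.
  + by clear - x1 x2 r0 r2K; rewrite ler_norml; apply/andP; split; lra.
- apply: inj; [by clear - r0 r2K; lra..|].
  move=> x /andP[x1 x2]; apply: (pitchfork_slope_middle r0 _ (fde x _)).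
  + by clear - x1 x2 r0; rewrite ler_norml; apply/andP; split; lra.
  + by clear - x1 x2 r0 r2K; rewrite ler_norml; apply/andP; split; lra.
- apply: inj; [by clear - r0 r2K; lra..|].
  move=> x /andP[x1 x2]; apply: (pitchfork_slope_outer r0 _ (fde x _)).
  + by clear - x1 x2 r0; rewrite ger0_norm; lra.
  + by clear - x1 x2 r0 r2K; rewrite ler_norml; apply/andP; split; lra.
- move=> u /andP[u1 u2]; rewrite -[u]opprK gt_eqF // pos //.
  by clear - u1 u2; apply/andP; split; lra.
- by move=> u /neg; apply: ltr0_neq0.
Qed.

(** The two preceding lemmas, with a window K and a range delta fixed before e.
    K may be taken arbitrarily small, which is needed because the reduced
    function only represents the vector field near the origin. *)
Lemma pitchfork_zeros (f df : R -> R -> R) (C r0 : R) : 0 < C -> 0 < r0 ->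
  (forall u e : R, `|u| < r0 -> `|e| < r0 -> is_derive u 1 (f^~ e) (df u e)) ->
  (forall e : R, `|e| < r0 -> `|f 0 e| <= C * e ^+ 2) ->
  (forall eta : R, 0 < eta -> exists2 rho : R, 0 < rho & forall u e :
      R, `|u| < rho -> `|e| < rho ->
     `|df u e - 3 * (u ^+ 2 - e)| <= eta * (u ^+ 2 + `|e|)) ->
  forall K0 : R, 0 < K0 -> exists K delta : R, [/\ 0 < K < K0, 0 < delta < K0,
   forall e : R, - delta < e <= 0 -> exists2 s, zero_list (f^~ e) K s & size s = 1%N &
   forall e : R, 0 < e < delta -> exists2 s, zero_list (f^~ e) K s & size s = 3%N ].
Proof.
move=> C0 r00 fdf f0 dfe K0 K00.
have eta0 : 0 < 100^-1 :> R by rewrite invr_gt0 ltr0n.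
have [rho rho0 dfrho] := dfe _ eta0.
pose K := Num.min K0 (Num.min r0 rho) / 2.
have m0 : 0 < Num.min K0 (Num.min r0 rho) by rewrite !lt_min K00 r00 rho0.
have mK : Num.min K0 (Num.min r0 rho) = 2 * K by rewrite /K; field.
have Kpos : 0 < K by rewrite divr_gt0.
have [KK0 Kr0 Krho] : [/\ K < K0, K < r0 & K < rho].
  have: Num.min K0 (Num.min r0 rho) <= K0 /\ Num.min K0 (Num.min r0 rho) <= r0 /\
    Num.min K0 (Num.min r0 rho) <= rho by rewrite !ge_min !lexx ?orbT.
  by rewrite mK => -[? [? ?]]; split; lra.
(* K / C bounds the error on f for e <= 0; K^2 / 4 puts 2 sqrt e inside the window,
   and (16 C^2)^-1 makes C e^2 at most (sqrt e)^3 / 4 for e > 0. *)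
pose delta := Num.min K (Num.min (K / C) (Num.min (K ^+ 2 / 4) (16 * C ^+ 2)^-1)).
have delta0 : 0 < delta.
  have C2 : 0 < 16 * C ^+ 2 by rewrite mulr_gt0 ?ltr0n ?exprn_gt0.
  by rewrite !lt_min Kpos invr_gt0 C2 !divr_gt0 ?exprn_gt0 ?ltr0n.
have [dK dC d4 d16] : [/\ delta <= K, delta <= K / C, delta <= K ^+ 2 / 4 & delta <= (16 * C ^+
    2)^-1].
  by split; rewrite !ge_min lexx ?orbT.
have dCK : delta * C <= K by rewrite -ler_pdivlMr.
have d16' : delta * (16 * C ^+ 2) <= 1.
  by rewrite -ler_pdivlMr ?div1r // mulr_gt0 ?exprn_gt0 ?ltr0n.
have de (e : R) : `|e| < delta -> `|e| < r0 /\ `|e| < rho.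
  by move=> /lt_le_trans/(_ dK) eK; rewrite (lt_trans eK Kr0) (lt_trans eK Krho).
exists K, delta; split; [by rewrite Kpos| by rewrite delta0 (le_lt_trans dK)| | ].
- move=> e /andP[ed e0].
  have eE : `|e| = - e by rewrite ler0_norm.
  have ed' : - e < delta by clear - ed; lra.
  have [er er'] : `|e| < r0 /\ `|e| < rho by apply: de; rewrite eE.
  apply: (@pitchfork_one_zero (f^~ e) (df^~ e) e C K) => //.
  + by move=> x xK; apply: fdf => //; apply: le_lt_trans xK Kr0.
  + by move=> x xK; apply: dfrho => //; apply: le_lt_trans xK Krho.
  + exact: f0.
  + rewrite eE expr2.
    have Ce : C * - e <= K.
      by apply: le_trans dCK; rewrite mulrC ler_wpM2r // ltW.
    have : 0 <= - e * (K - C * - e) by clear - e0 Ce; apply: mulr_ge0; lra.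
    by clear; lra.
- move=> e /andP[e0 ed].
  have eE : `|e| = e by rewrite ger0_norm ?(ltW e0).
  have [e1 e2] : `|e| < r0 /\ `|e| < rho by apply: de; rewrite eE.
  pose r := Num.sqrt e.
  have r0' : 0 < r by rewrite sqrtr_gt0.
  have er : r ^+ 2 = e by rewrite sqr_sqrtr // ltW.
  have r2K : 2 * r < K.
    rewrite -(@ltr_pXn2r _ 2) ?nnegrE //; [|by rewrite mulr_ge0 ?ltW|exact: ltW].
    by clear - er d4 ed; rewrite exprMn er; lra.
  have Cr : C * r <= 4^-1.
    rewrite -(@ler_pXn2r _ 2) ?nnegrE ?invr_ge0 //; last by rewrite mulr_ge0 ?ltW.
    rewrite exprMn er.
    have : C ^+ 2 * e <= C ^+ 2 * delta by rewrite ler_wpM2l ?sqr_ge0 ?ltW.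
    by clear - d16'; lra.
  apply: (@pitchfork_three_zeros (f^~ e) (df^~ e) r K) => //.
  + by move=> x xK; apply: fdf => //; apply: le_lt_trans xK Kr0.
  + move=> x xK; rewrite er -[X in _ <= _ * (_ + X)]eE.
    by apply: dfrho => //; apply: le_lt_trans xK Krho.
  + apply: le_trans (f0 _ e1) _.
    have -> : C * e ^+ 2 = C * r * r ^+ 3 by rewrite -er; ring.
    by rewrite ler_wpM2r // exprn_ge0 // ltW.
Qed.
End Pitchfork.

(** * Closure properties of smooth functions *)

Section Smooth.
Variables (R : realType) (E : normedModType R) (Omega : set E).
Hypothesis Omega_open : open Omega.

(** g - f vanishes near z, hence is differentiable with zero differential. *)
Lemma near_eq_differentiable (E' : normedModType R) (f g : E -> E') (z : E) :
  {near z, f =1 g} -> differentiable f z -> differentiable g z.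
Proof.
move=> fg df; have -> : g = f + (g - f) by apply/funext => x; rewrite !fctE addrC subrK.
apply: differentiableD => //.
have h0 : \forall y \near z, (g - f) y = 0.
  by apply: filterS fg => y fgy; rewrite !fctE fgy subrr.
apply/diffP => /=.
apply: (@getPex _ (fun (df : {linear E -> E'}) => continuous df /\
  forall y, (g - f) y = (g - f) (lim (nbhs z)) + df (y - lim (nbhs z))
                  +o_(y \near z) (y - lim (nbhs z)))).
exists (\0 : {linear E -> E'}); split; first by move=> y; exact: cvg_cst.
have lz : lim (nbhs z) = z by exact: lim_id.
have hz : (g - f) z = 0 by exact: nbhs_singleton h0.
pose F := nbhs_filter_on z.
have : g - f = (cst ((g - f) (lim (nbhs z))) + ((\0 : E -> E') \o center (lim (nbhs z))))
    +o_F (center (lim (nbhs z))).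
  apply/eqaddoP => eps eps0; near=> y.
  rewrite [X in `|X| <= _](_ : _ = 0); first by rewrite normr0 mulr_ge0 // ltW.
  rewrite [LHS](_ : _ = (g - f) y - ((g - f) (lim (nbhs z)) + 0)) //.
  have -> : (g - f) y = 0 by near: y.
  by rewrite lz hz addr0 subrr.
by rewrite {1}funeqE.
Unshelve. all: by end_near. Qed.

Lemma foldr_derive_eq (E' : normedModType R) (f g : E -> E') (vs : seq E) :
  (forall z, Omega z -> f z = g z) -> forall z, Omega z ->
  foldr (fun v h => 'D_v h) f vs z = foldr (fun v h => 'D_v h) g vs z.
Proof.
move=> fg; elim: vs => [|v vs IH] z Oz /=; first exact: fg.
by apply: near_eq_derive; near=> y; apply: IH; near: y; exact: open_nbhs_nbhs.
Unshelve. all: by end_near. Qed.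

(** Smoothness is not directly inductive: the derivative of a product is a sum of
    products, so closure under products needs a bound on the number of
    derivatives to carry the induction. *)
Definition smooth_upto (E' : normedModType R) (k : nat) (f : E -> E') :=
  forall (vs : seq E) (z : E), (size vs <= k)%N -> Omega z ->
    differentiable (foldr (fun v g => 'D_v g) f vs) z.

Lemma smooth_uptoP (E' : normedModType R) (f : E -> E') :
  smooth_on Omega f <-> forall k, smooth_upto k f.
Proof.
split=> [sf k vs z _|sf vs z]; first exact: sf.
exact: (sf (size vs)).
Qed.

Lemma smooth_upto_eq (E' : normedModType R) k (f g : E -> E') :
  (forall z, Omega z -> f z = g z) -> smooth_upto k f -> smooth_upto k g.
Proof.
move=> fg sf vs z vsk Oz; apply: near_eq_differentiable (sf vs z vsk Oz).
near=> y; apply: foldr_derive_eq => //; near: y; exact: open_nbhs_nbhs.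
Unshelve. all: by end_near. Qed.

Lemma smooth_uptoS (E' : normedModType R) k (f : E -> E') :
  smooth_upto k.+1 f <->
  (forall z, Omega z -> differentiable f z) /\ forall v, smooth_upto k ('D_v f).
Proof.
split=> [sf|[df sf] vs z].
  split=> [z|v vs z vsk Oz]; first exact: (sf [::]).
  by have := sf (rcons vs v) z; rewrite size_rcons foldr_rcons; apply.
by elim/last_ind: vs => [|vs v _]; [move=> _; exact: df|rewrite size_rcons foldr_rcons; exact:
    sf].
Qed.

Lemma smooth_upto0 (E' : normedModType R) (f : E -> E') :
  smooth_upto 0 f <-> forall z, Omega z -> differentiable f z.
Proof. by split=> [sf z|df [|//] z _]; [exact: (sf [::])|exact: df]. Qed.

Lemma smooth_uptoW (E' : normedModType R) k (f : E -> E') :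
  smooth_upto k.+1 f -> smooth_upto k f.
Proof. by move=> sf vs z /leqW; apply: sf. Qed.

Lemma smooth_upto_cst (E' : normedModType R) k (a : E') : smooth_upto k (cst a).
Proof.
elim: k a => [|k IH] a; first by apply/smooth_upto0 => z _; exact: differentiable_cst.
apply/smooth_uptoS; split=> [z _|v]; first exact: differentiable_cst.
by apply: smooth_upto_eq (IH 0) => z _; rewrite derive_cst.
Qed.

Lemma smooth_uptoD (E' : normedModType R) k (f g : E -> E') :
  smooth_upto k f -> smooth_upto k g -> smooth_upto k (fun z => f z + g z).
Proof.
have dD (h1 h2 : E -> E') z : differentiable h1 z -> differentiable h2 z ->
  differentiable (fun x => h1 x + h2 x) z := @differentiableD _ _ _ h1 h2 z.
elim: k f g => [|k IH] f g.
  by rewrite !smooth_upto0 => df dg z Oz; apply: dD; [exact: df|exact: dg].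
rewrite !smooth_uptoS => -[df sf] [dg sg]; split=> [z Oz|v].
  by apply: dD; [exact: df|exact: dg].
apply: smooth_upto_eq (IH _ _ (sf v) (sg v)) => z Oz.
by rewrite [RHS](@deriveD _ _ _ f g) //; apply: diff_derivable; [exact: df|exact: dg].
Qed.

Lemma smooth_uptoM k (f g : E -> R) :
  smooth_upto k f -> smooth_upto k g -> smooth_upto k (fun z => f z * g z).
Proof.
have dM (h1 h2 : E -> R) z : differentiable h1 z -> differentiable h2 z ->
  differentiable (fun x => h1 x * h2 x) z := @differentiableM _ _ h1 h2 z.
elim: k f g => [|k IH] f g.
  by rewrite !smooth_upto0 => df dg z Oz; apply: dM; [exact: df|exact: dg].
move=> sf sg; have sfW := smooth_uptoW sf; have sgW := smooth_uptoW sg.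
move: sf sg; rewrite !smooth_uptoS => -[df sf] [dg sg]; split=> [z Oz|v].
  by apply: dM; [exact: df|exact: dg].
apply: smooth_upto_eq (smooth_uptoD (IH _ _ sfW (sg v)) (IH _ _ sgW (sf v))) => z Oz.
by rewrite [RHS](@deriveM _ _ f g) //; apply: diff_derivable; [exact: df|exact: dg].
Qed.

Lemma smooth_on_eq (E' : normedModType R) (f g : E -> E') :
  (forall z, Omega z -> f z = g z) -> smooth_on Omega f -> smooth_on Omega g.
Proof. by rewrite !smooth_uptoP => fg sf k; apply: smooth_upto_eq (sf k). Qed.

Lemma smooth_on_derive (E' : normedModType R) (f : E -> E') v :
  smooth_on Omega f -> smooth_on Omega ('D_v f).
Proof. by rewrite !smooth_uptoP => sf k; have /smooth_uptoS[] := sf k.+1. Qed.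

Lemma smooth_on_cst (E' : normedModType R) (a : E') : smooth_on Omega (fun=> a).
Proof. by rewrite !smooth_uptoP => k; exact: smooth_upto_cst. Qed.

Lemma smooth_onD (E' : normedModType R) (f g : E -> E') :
  smooth_on Omega f -> smooth_on Omega g -> smooth_on Omega (fun z => f z + g z).
Proof. by rewrite !smooth_uptoP => sf sg k; apply: smooth_uptoD. Qed.

Lemma smooth_onM (f g : E -> R) :
  smooth_on Omega f -> smooth_on Omega g -> smooth_on Omega (fun z => f z * g z).
Proof. by rewrite !smooth_uptoP => sf sg k; apply: smooth_uptoM. Qed.

Lemma smooth_on_sum (I : Type) (r : seq I) (P : pred I) (f : I -> E -> R) :
  (forall i, smooth_on Omega (f i)) -> smooth_on Omega (fun z => \sum_(i <- r | P i) f i z).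
Proof.
move=> sf; elim: r => [|i r IH].
  by apply: smooth_on_eq (smooth_on_cst 0) => z _; rewrite big_nil.
case Pi : (P i).
  by apply: smooth_on_eq (smooth_onD (sf i) IH) => z _; rewrite big_cons Pi.
by apply: smooth_on_eq IH => z _; rewrite big_cons Pi.
Qed.

Lemma smooth_on_prod (I : Type) (r : seq I) (P : pred I) (f : I -> E -> R) :
  (forall i, smooth_on Omega (f i)) -> smooth_on Omega (fun z => \prod_(i <- r | P i) f i z).
Proof.
move=> sf; elim: r => [|i r IH].
  by apply: smooth_on_eq (smooth_on_cst (1 : R)) => z _; rewrite big_nil.
case Pi : (P i).
  by apply: smooth_on_eq (smooth_onM (sf i) IH) => z _; rewrite big_cons Pi.
by apply: smooth_on_eq IH => z _; rewrite big_cons Pi.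
Qed.

Lemma smooth_on_det n (A : E -> 'M[R]_n) :
  (forall i j, smooth_on Omega (fun z => A z i j)) -> smooth_on Omega (fun z => \det (A z)).
Proof.
move=> sA; rewrite /determinant; apply: smooth_on_sum => s.
by apply: smooth_onM; [exact: smooth_on_cst|apply: smooth_on_prod].
Qed.

Lemma smooth_on_adj n (A : E -> 'M[R]_n) i j :
  (forall i j, smooth_on Omega (fun z => A z i j)) -> smooth_on Omega (fun z => \adj (A z) i j).
Proof.
move=> sA.
have sdet : smooth_on Omega (fun z => \det (row' j (col' i (A z)))).
  apply: smooth_on_det => a b.
  by apply: smooth_on_eq (sA (lift j a) (lift i b)) => z _; rewrite !mxE.
apply: smooth_on_eq (smooth_onM (smooth_on_cst ((-1) ^+ (j + i) : R)) sdet) => z _.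
by rewrite !mxE.
Qed.

Lemma smooth_on_coord m n (G : E -> 'M[R]_(m, n)) i j :
  smooth_on Omega G -> smooth_on Omega (fun z => G z i j).
Proof.
have dc (h : E -> 'M[R]_(m, n)) z : differentiable h z -> differentiable (fun x => h x i j) z.
  move=> dh; apply: (@differentiable_comp _ _ _ _ h (fun N : 'M[R]_(m, n) => N i j)) => //.
  exact: differentiable_coord.
rewrite !smooth_uptoP => sG k; have {sG} := sG k.
elim: k G => [|k IH] G; first by rewrite !smooth_upto0 => dG z /dG; exact: dc.
rewrite !smooth_uptoS => -[dG sG]; split=> [z /dG|v]; first exact: dc.
apply: smooth_upto_eq (IH _ (sG v)) => z Oz.
by rewrite derive_mx ?mxE //; apply: diff_derivable; exact: dG.
Qed.

End Smooth.

(** * Taylor expansions along lines *)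

Lemma near0_radius (R : realType) (E : normedModType R) (P : E -> Prop) :
    (\forall z \near 0, P z) ->
  exists2 rho : R, 0 < rho & forall z, `|z| < rho -> P z.
Proof. by move=> /nbhs_norm0P[rho rho0 h]; exists rho. Qed.

Section Lines.
Variables (R : realType) (E : normedModType R).

Lemma is_derive_line (E' : normedModType R) (f : E -> E') (z w : E) (t : R) :
  differentiable f (z + t *: w) ->
  is_derive t 1 (fun s : R => f (z + s *: w)) ('D_w f (z + t *: w)).
Proof.
move=> df; have dw : derivable f (z + t *: w) w by exact: diff_derivable.
have eqq : (fun h : R => h^-1 *: (((fun s : R => f (z + s *: w)) \o shift t) (h *:
    1) - f (z + t *: w)))
   = (fun h => h^-1 *: ((f \o shift (z + t *: w)) (h *: w) - f (z + t *: w))).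
  apply/funext => h /=; congr (_ *: (f _ - _)).
  by rewrite /shift /= [h *: 1]mulr1 scalerDl addrCA.
by split; rewrite /derivable /derive eqq.
Qed.

Lemma mean_value_line (f : E -> R) (z w : E) :
  (forall t : R, 0 <= t <= 1 -> differentiable f (z + t *: w)) ->
  exists2 t : R, 0 <= t <= 1 & f (z + w) - f z = 'd f (z + t *: w) w.
Proof.
move=> df.
have [t /df ?|t /andP[t0 t1]] := @mean_value R (fun s : R => f (z + s *: w))
   (fun t => 'D_w f (z + t *: w)) 0 1 ltr01; first exact: is_derive_line.
rewrite scale1r scale0r addr0 subr0 mulr1 => ->.
have t01 : 0 <= t <= 1 by rewrite !ltW.
by exists t => //; rewrite deriveE //; apply: df.
Qed.

(** A mean value argument applied to the remainder: its derivative at s t v is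
    t times the first order remainder of 'D_v f, which is o(t). *)
Lemma taylor2_line (Omega : set E) (f : E -> R) (v : E) (eta : R) :
  open Omega -> Omega 0 -> smooth_on Omega f -> 0 < eta ->
  exists2 rho : R, 0 < rho & forall t : R, `|t| < rho ->
    `|f (t *: v) - f 0 - t * 'D_v f 0 - t ^+ 2 / 2 * 'D_v ('D_v f) 0| <= eta * t ^+ 2.
Proof.
move=> Oo O0 sf eta0.
have df z : Omega z -> differentiable f z by exact: (sf [::]).
have ddf z : Omega z -> differentiable ('D_v f) z by exact: (sf [:: v]).
have [r0 r00 Or0] : exists2 r0 : R, 0 < r0 & forall z, `|z| < r0 -> Omega z.
  by apply: near0_radius; exact: open_nbhs_nbhs.
have [r1 r10 Or1] : exists2 r1 : R, 0 < r1 & forall t : R, `|t| < r1 -> Omega (t *: v).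
  have v0 : 0 < `|v| + 1 by rewrite ltr_wpDl.
  exists (r0 / (`|v| + 1)) => [|t]; first by rewrite divr_gt0.
  rewrite ltr_pdivlMr // => tr; apply: Or0; rewrite normrZ; apply: le_lt_trans tr.
  by rewrite ler_wpM2l // lerDl.
pose psi (t : R) := 'D_v f (0 + t *: v).
have dpsi : is_derive (0 : R) (1 : R) psi ('D_v ('D_v f) 0).
  have := @is_derive_line _ ('D_v f) 0 v 0; rewrite scale0r addr0; apply.
  exact: ddf.
have psiE : psi 0 = 'D_v f 0 by rewrite /psi scale0r addr0.
have [r2 r20 psir] : exists2 r2 : R, 0 < r2 & forall t : R, `|t| < r2 ->
    `|psi t - 'D_v f 0 - t * 'D_v ('D_v f) 0| <= eta * `|t|.
  have [dc dE] := dpsi; move: (dc); rewrite /derivable.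
  move=> /cvgrPdist_le/(_ _ eta0); rewrite -[lim _]/('D_1 psi 0) dE.
  rewrite near_withinE => /near0_radius[r2 r20 H]; exists r2 => // t tr.
  have [->|t0] := eqVneq t 0; first by rewrite psiE mul0r subr0 subrr normr0 mulr0.
  have := H t tr t0; rewrite /= /shift /= addr0 [t *: 1]mulr1 psiE.
  rewrite -(ler_pM2r (_ : 0 < `|t|)) ?normr_gt0 // -normrM distrC.
  by congr (`|_| <= _); rewrite /GRing.scale /=; field.
exists (Num.min r1 r2); first by rewrite lt_min r10 r20.
move=> t; rewrite lt_min => /andP[tr1 tr2].
pose k (s : R) := f (0 + s *: (t *: v)) - s * (t * 'D_v f 0)
  - s ^+ 2 * (t ^+ 2 / 2 * 'D_v ('D_v f) 0).
have st (s : R) : 0 <= s <= 1 -> `|s * t| <= `|t|.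
  by move=> /andP[s0 s1]; rewrite normrM ger0_norm // ler_piMl.
pose dk (s : R) := t * (psi (s * t) - 'D_v f 0 - s * t * 'D_v ('D_v f) 0).
have kdk (s : R) : 0 <= s <= 1 -> is_derive s 1 k (dk s).
  move=> /st /le_lt_trans/(_ tr1) /Or1 Ost.
  have Ost' : Omega (0 + s *: (t *: v)) by rewrite add0r scalerA.
  have dfs := @is_derive_line _ f 0 (t *: v) s (df _ Ost').
  have dline : 'D_(t *: v) f (0 + s *: (t *: v)) = t * psi (s * t).
    by rewrite /psi !deriveE ?scalerA ?linearZ //; apply: df; rewrite -?scalerA.
  rewrite dline in dfs; rewrite /k; apply: is_derive_eq.
  rewrite /dk; move: (psi _) ('D_v f 0) ('D_v ('D_v f) 0) => a b c.
  by rewrite /GRing.scale /=; field.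
have [s /andP[s0 s1]] := @mean_value _ k dk 0 1 ltr01 kdk.
have s01 : 0 <= s <= 1 by rewrite !ltW.
rewrite subr0 mulr1 {1 2}/k !scale1r !scale0r !add0r expr0n /= !mul0r !mul1r expr1n mul1r !subr0.
rewrite addrAC [X in X - _]addrAC => ->.
rewrite /dk normrM -(real_normK (num_real t)).
apply: le_trans (_ : _ <= `|t| * (eta * `|s * t|)) _.
  by rewrite ler_wpM2l // psir // (le_lt_trans (st _ s01)).
rewrite mulrCA ler_wpM2l ?(ltW eta0) //.
by rewrite expr2 ler_wpM2l // st.
Qed.
End Lines.

(** * Strict differentiability at the origin *)

Section Norms.
Variable R : realType.

Lemma normr_cV_coord n (x : 'cV[R]_n) i : `|x i 0| <= `|x|.
Proof. by rewrite /Num.Def.normr /= mx_normrE; apply: (le_bigmax _ _ (i, 0)). Qed.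

Lemma normr_cV_le n (x : 'cV[R]_n) (c : R) : 0 <= c ->
  (forall i, `|x i 0| <= c) -> `|x| <= c.
Proof.
move=> c0 xc; rewrite /Num.Def.normr /= mx_normrE; apply: bigmax_le => // -[i j] _.
by rewrite (ord1 j).
Qed.

Lemma normr_pair_le n (x : 'cV[R]_n) (e c : R) :
  (`|(x, e)| <= c) = (`|x| <= c) && (`|e| <= c).
Proof. by rewrite prod_normE /= ge_max. Qed.

Lemma pair_basis n (z : 'cV[R]_n * R) :
  z = \sum_j z.1 j 0 *: (delta_mx j 0, 0) + z.2 *: (0, 1).
Proof.
case: z => x e /=; rewrite [X in X + _](_ : _ = (x, 0)).
  by congr (_, _) => /=; rewrite ?scaler0 ?addr0 // add0r [_ *: _]mulr1.
have xE : x = \sum_j x j 0 *: delta_mx j 0.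
  by rewrite {1}[x]matrix_sum_delta; apply: eq_bigr => i _; rewrite big_ord1.
apply/esym; rewrite [in LHS]xE.
elim: (index_enum _) => [|j r IH]; first by rewrite !big_nil.
by rewrite !big_cons -IH; congr (_, _); rewrite /= scaler0 addr0.
Qed.

Lemma convex_ball (E : normedModType R) (z1 z2 : E) (rho t : R) :
  `|z1| < rho -> `|z2| < rho -> 0 <= t <= 1 -> `|z2 + t *: (z1 - z2)| < rho.
Proof.
move=> z1r z2r /andP[t0 t1].
have -> : z2 + t *: (z1 - z2) = (1 - t) *: z2 + t *: z1.
  by rewrite scalerBr scalerBl scale1r -addrA [- _ + _]addrC.
apply: le_lt_trans (ler_normD _ _) _; rewrite !normrZ !ger0_norm ?subr_ge0 //.
have [->|tn0] := eqVneq t 0; first by rewrite subr0 mul1r mul0r addr0.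
have : t * `|z1| < t * rho by rewrite ltr_pM2l // lt_neqAle eq_sym tn0.
have : (1 - t) * `|z2| <= (1 - t) * rho by rewrite ler_wpM2l ?subr_ge0 // ltW.
lra.
Qed.

Lemma diff_pair_expand n (f : 'cV[R]_n * R -> R) (z w : 'cV[R]_n * R) :
  differentiable f z ->
  'd f z w = \sum_j w.1 j 0 * 'D_(delta_mx j 0, 0) f z + w.2 * 'D_(0, 1) f z.
Proof.
move=> df; rewrite {1}(pair_basis w) linearD linearZ /= linear_sum deriveE //.
by congr (_ + _); apply: eq_bigr => j _; rewrite linearZ deriveE.
Qed.

(** By the mean value theorem the error is ('d f z - 'd f 0) w at some z of the
    segment.  In finite dimension continuity of the partial derivatives makes it
    small uniformly in w. *)
Lemma strict_differentiability n (Omega : set ('cV[R]_n * R)) (f : 'cV[R]_n * R -> R) (eta : R) :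
  open Omega -> Omega 0 -> smooth_on Omega f -> 0 < eta ->
  exists2 rho : R, 0 < rho & forall z1 z2, `|z1| < rho -> `|z2| < rho ->
    `|f z1 - f z2 - 'd f 0 (z1 - z2)| <= eta * `|z1 - z2|.
Proof.
move=> Oo O0 sf eta0.
have df z : Omega z -> differentiable f z by exact: (sf [::]).
pose eta' : R := eta / n.+1%:R.
have eta'0 : 0 < eta' by rewrite divr_gt0 ?ltr0n.
have near_dir (v : 'cV[R]_n * R) : \forall z \near 0, `|'D_v f z - 'D_v f 0| <= eta'.
  have /differentiable_continuous : differentiable ('D_v f) 0 by exact: (sf [:: v]).
  move=> /(@cvgrPdist_le _ _ _ _ _)/(_ _ eta'0); apply: filterS => z /=.
  by rewrite distrC.
have [rho rho0 H] : exists2 rho : R, 0 < rho & forall z, `|z| < rho ->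
   [/\ Omega z, forall j : 'I_n, `|'D_(delta_mx j 0, 0) f z - 'D_(delta_mx j 0, 0) f 0| <= eta' &
      `|'D_(0, 1) f z - 'D_(0, 1) f 0| <= eta' ].
  apply: near0_radius; near=> z; split.
  - by near: z; exact: open_nbhs_nbhs.
  - by near: z; apply: filter_forall => j; exact: near_dir.
  - by near: z; exact: near_dir.
exists rho => // z1 z2 z1r z2r.
set w := z1 - z2.
have dO (t : R) : 0 <= t <= 1 -> Omega (z2 + t *: w).
  by move=> t01; have [] := H _ (convex_ball z1r z2r t01).
have [t t01] := @mean_value_line _ _ f z2 w (fun t t01 => df _ (dO t t01)).
rewrite [z2 + w]subrKC => ->.
have [Oz Hj He] := H _ (convex_ball z1r z2r t01); rewrite -/w in Oz Hj He.
move: (z2 + t *: w) => z in Oz Hj He *.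
suff key (a b : R) :
    a = \sum_j w.1 j 0 * 'D_(delta_mx j 0, 0) f z + w.2 * 'D_(0, 1) f z ->
    b = \sum_j w.1 j 0 * 'D_(delta_mx j 0, 0) f 0 + w.2 * 'D_(0, 1) f 0 ->
    `|a - b| <= eta * `|w|.
  exact: key (diff_pair_expand w (df z Oz)) (diff_pair_expand w (df 0 O0)).
move=> -> ->; rewrite opprD addrACA -sumrB -mulrBr.
apply: le_trans (ler_normD _ _) _.
have -> : eta * `|w| = \sum_(j < n) `|w| * eta' + `|w| * eta'.
  by rewrite sumr_const card_ord -mulrSr -mulr_natr /eta'; field; rewrite addrC natr1 pnatr_eq0.
have [w1 w2] : `|w.1| <= `|w| /\ `|w.2| <= `|w|.
  by have := lexx `|w|; rewrite {1}[w]surjective_pairing normr_pair_le => /andP.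
apply: lerD; last by rewrite normrM; apply: ler_pM.
apply: le_trans (ler_norm_sum _ _ _) _; apply: ler_sum => j _.
rewrite -mulrBr normrM; apply: ler_pM => //.
by apply: le_trans w1; exact: normr_cV_coord.
Unshelve. all: by end_near. Qed.
End Norms.

(** * Fixed points in a closed ball *)

Lemma fixed_point_in_ball (R : realType) (X : completeNormedModType R) (N : X -> X) (rho : R) :
  0 <= rho ->
  (forall y, `|y| <= rho -> `|N y| <= rho) ->
  (forall y1 y2, `|y1| <= rho -> `|y2| <= rho -> `|N y1 - N y2| <= 2^-1 * `|y1 - y2|) ->
  exists2 y, `|y| <= rho & y = N y.
Proof.
move=> rho0 Nball Nlip.
pose U := [set y : X | `|y| <= rho].
have fU : set_fun U U N by move=> y; exact: Nball.
have := @banach_fixed_point R X U (mkfun fU).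
apply.
- exists 2^-1%:nng; split => /=; first lra.
  by move=> [y1 y2] [/= U1 U2]; exact: Nlip.
- have -> : U = (fun y => `|y|) @^-1` [set r | r <= rho] by [].
  apply: preimage_closed; first by move=> y _; exact: norm_continuous.
  exact: closed_le.
- by exists 0; rewrite /U /= normr0.
Qed.

(** The contraction principle is applied in 'cV[R]_m. *)
HB.instance Definition _ (R : realType) (m n : nat) :=
  Uniform_isComplete.Build 'M[R]_(m, n) (@mx_complete R m n).

(** * The coordinates (u, y, e) *)

Section Coordinates.
Variables (R : realType) (m : nat).
Implicit Types (u e : R) (y : 'cV[R]_m).

Definition pt u y e : 'cV[R]_(1 + m) * R := (col_mx u%:M y, e).

Lemma ptB u1 y1 e1 u2 y2 e2 :
  pt u1 y1 e1 - pt u2 y2 e2 = pt (u1 - u2) (y1 - y2) (e1 - e2).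
Proof.
by congr (_, _); rewrite /= opp_col_mx add_col_mx -(raddfB (@scalar_mx R 1)).
Qed.

Lemma ptD u1 y1 e1 u2 y2 e2 :
  pt u1 y1 e1 + pt u2 y2 e2 = pt (u1 + u2) (y1 + y2) (e1 + e2).
Proof. by congr (_, _); rewrite /= add_col_mx -(raddfD (@scalar_mx R 1)). Qed.

Lemma ptZ a u y e : a *: pt u y e = pt (a * u) (a *: y) (a * e).
Proof. by congr (_, _); rewrite /= scale_col_mx scale_scalar_mx. Qed.

Lemma pt0 : pt 0 0 0 = 0.
Proof. by congr (_, _); rewrite raddf0 col_mx0. Qed.

Lemma u_dirE : u_dir R m = pt 1 0 0. Proof. by []. Qed.

Lemma y_dirE y : y_dir y = pt 0 y 0.
Proof. by congr (_, _); rewrite raddf0. Qed.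

Lemma ptE (z : 'cV[R]_(1 + m) * R) : z = pt (z.1 (lshift m 0) 0) (dsubmx z.1) z.2.
Proof.
case: z => x e; congr (_, _) => /=; rewrite -[LHS]vsubmxK; congr (col_mx _ _).
by apply/matrixP => i j; rewrite !ord1 !mxE mulr1n.
Qed.

Lemma norm_pt u y e : `|pt u y e| = Num.max (Num.max `|u| `|y|) `|e|.
Proof.
rewrite prod_normE /=; congr (Num.max _ _).
apply/eqP; rewrite eq_le; apply/andP; split.
  apply: normr_cV_le; first by rewrite le_max normr_ge0.
  move=> i; case: (split_ordP i) => j ->.
    by rewrite col_mxEu (ord1 j) mxE mulr1n le_max lexx.
  by rewrite col_mxEd le_max normr_cV_coord orbT.
rewrite ge_max; apply/andP; split.
  by have := normr_cV_coord (col_mx u%:M y) (lshift m 0); rewrite col_mxEu mxE mulr1n.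
apply: normr_cV_le => // i.
by have := normr_cV_coord (col_mx u%:M y) (rshift 1 i); rewrite col_mxEd.
Qed.

Lemma norm_pt_le u y e c : (`|pt u y e| <= c) = [&& `|u| <= c, `|y| <= c & `|e| <= c].
Proof. by rewrite norm_pt !ge_max andbA. Qed.

Lemma norm_pt_lt u y e c : (`|pt u y e| < c) = [&& `|u| < c, `|y| < c & `|e| < c].
Proof. by rewrite norm_pt !gt_max andbA. Qed.

Lemma mulmx_bound n p (A : 'M[R]_(n, p)) :
  exists2 c : R, 0 < c & forall v : 'cV[R]_p, `|A *m v| <= c * `|v|.
Proof.
pose c : R := \sum_i \sum_j `|A i j|.
have c0 : 0 <= c by apply: sumr_ge0 => i _; apply: sumr_ge0.
exists (c + 1) => [|v]; first by rewrite ltr_wpDl.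
apply: (@le_trans _ _ (c * `|v|)); last by rewrite ler_wpM2r // lerDl.
apply: normr_cV_le => [|i]; first by rewrite mulr_ge0.
rewrite mxE; apply: le_trans (ler_norm_sum _ _ _) _.
apply: (@le_trans _ _ ((\sum_j `|A i j|) * `|v|)).
  rewrite mulr_suml; apply: ler_sum => j _.
  by rewrite normrM ler_wpM2l // normr_cV_coord.
rewrite ler_wpM2r // /c (bigD1 i) //= lerDl.
by apply: sumr_ge0 => k _; apply: sumr_ge0.
Qed.

(** Estimates on vectors are obtained coordinate by coordinate, each with its own
    radius. *)
Lemma common_radius (I : finType) (P : I -> R -> Prop) :
  (forall i r s, r <= s -> P i s -> P i r) ->
  (forall i, exists2 r : R, 0 < r & P i r) ->
  exists2 r : R, 0 < r & forall i, P i r.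
Proof.
move=> Pmono /(_ _)/cid2 H.
pose r i := s2val (H i).
exists (\big[Num.min/1]_i r i).
  by apply/bigmin_gtP; split => // i _; exact: s2valP (H i).
by move=> i; apply: Pmono (s2valP' (H i)); apply: bigmin_le_cond.
Qed.

End Coordinates.

(** A singular M would have the eigenvalue 0, whose real part is 0. *)
Lemma hyperbolic_unitmx (R : realType) m (M : 'M[R]_m) : hyperbolic_mx M -> M \in unitmx.
Proof.
move=> hM; rewrite unitmxE unitfE; apply/eqP => detM.
have : eigenvalue (complexify M) 0.
  rewrite eigenvalue_root_char /root horner_coef0 char_poly_det.
  by rewrite det_map_mx detM rmorph0 mulr0.
by move/hM.
Qed.

(** * Differentials of families of vector fields *)

Section Generic.
Variable R : realType.

Lemma differentiable_bound (E : normedModType R) (f : E -> R) (z : E) (eta : R) :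
  differentiable f z -> 0 < eta ->
  exists2 rho : R, 0 < rho & forall w, `|w| < rho ->
    `|f (z + w) - f z - 'd f z w| <= eta * `|w|.
Proof.
move=> /diff_locally /eqaddoP dfz eta0; have := dfz _ eta0.
move=> /near0_radius[rho rho0 H]; exists rho => // w /H.
rewrite /= => h; apply: le_trans h.
by rewrite [z + w]addrC -addrA -opprD.
Qed.

Lemma derive_coord n (j : 'I_n) (z v : 'cV[R]_n * R) :
  is_derive z v (fun z : 'cV[R]_n * R => z.1 j 0) (v.1 j 0).
Proof.
have q : (fun h : R => h^-1 *: (((fun z : 'cV[R]_n * R => z.1 j 0) \o shift z) (h *:
    v) - z.1 j 0))
   @ 0^' --> v.1 j 0.
  apply: cvg_near_cst; near=> h.
  rewrite /= !mxE addrK [_ *: _]mulKf //.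
  by near: h; exact: nbhs_dnbhs_neq.
by split; [apply/cvg_ex; exists (v.1 j 0)|apply: cvg_lim].
Unshelve. all: by end_near. Qed.

Lemma smooth_on_fst_coord n (Omega : set ('cV[R]_n * R)) (j : 'I_n) :
  open Omega -> smooth_on Omega (fun z : 'cV[R]_n * R => z.1 j 0).
Proof.
move=> Oo.
have dc z : differentiable (fun z : 'cV[R]_n * R => z.1 j 0) z.
  apply: (@differentiable_comp _ _ _ _ fst (fun N : 'cV[R]_n => N j 0)).
    apply: (@linear_differentiable R _ _ (fst : {linear _ -> _})) => x; exact: cvg_fst.
  exact: differentiable_coord.
apply/smooth_uptoP => -[|k]; first by apply/smooth_upto0.
apply/smooth_uptoS; split=> // v.
apply: (@smooth_upto_eq R _ Omega Oo _ k (fun=> v.1 j 0)); last exact: smooth_upto_cst.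
by move=> z Oz; have [_ ->] := derive_coord j z v.
Qed.

Lemma derive_slice n (E' : normedModType R) (V : 'cV[R]_n * R -> E') (w : 'cV[R]_n) z :
  'D_w (fun x => V (x, z.2)) z.1 = 'D_(w, 0) V z.
Proof.
case: z => x e; rewrite /derive; apply: (congr1 (fun f : R -> E' => lim (f @ 0^'))).
apply/funext => h /=.
by congr (_ *: (V _ - _)); congr (_, _); rewrite /= scaler0 add0r.
Qed.

Lemma differentiable_mx (E : normedModType R) n (V : E -> 'cV[R]_n) z :
  (forall i, differentiable (fun z => V z i 0) z) -> differentiable V z.
Proof.
move=> dV.
have -> : V = \sum_(i < n) (fun z => V z i 0 *: (delta_mx i 0 : 'cV[R]_n)).
  apply/funext => x; rewrite fct_sumE {1}[V x]matrix_sum_delta.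
  by apply: eq_bigr => i _; rewrite big_ord1.
by apply: differentiable_sum => i; apply: differentiableZl.
Qed.

Lemma diff_coord (E : normedModType R) n (V : E -> 'cV[R]_n) z w i :
  differentiable V z -> 'd (fun z => V z i 0) z w = ('d V z w) i 0.
Proof.
move=> dV; rewrite -!deriveE //; first by rewrite derive_mx ?mxE //; exact: diff_derivable.
apply: (@differentiable_comp _ _ _ _ V (fun N : 'cV[R]_n => N i 0)) => //.
exact: differentiable_coord.
Qed.

End Generic.

(** * The Jacobian of the family *)

Section Family.
Variables (R : realType) (n : nat) (V : 'cV[R]_n * R -> 'cV[R]_n)
  (Omega : set ('cV[R]_n * R)).
Hypotheses (Oo : open Omega) (sV : forall i, smooth_on Omega (fun z => V z i 0)).

Lemma family_differentiable z : Omega z -> differentiable V z.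
Proof. by move=> Oz; apply: differentiable_mx => i; exact: (sV i [::]). Qed.

Lemma DxV_entry z i j : Omega z ->
  DxV V z i j = 'D_(delta_mx j 0, 0) (fun z => V z i 0) z.
Proof.
move=> Oz; rewrite mxE derive_slice derive_mx ?mxE //.
by apply: diff_derivable; exact: family_differentiable.
Qed.

Lemma smooth_on_DxV i j : smooth_on Omega (fun z => DxV V z i j).
Proof.
apply: (smooth_on_eq Oo _ (smooth_on_derive (delta_mx j 0, 0) (sV i))) => z Oz.
by rewrite DxV_entry.
Qed.

Lemma smooth_on_detDxV : smooth_on Omega (detDxV V).
Proof. by apply: (smooth_on_det Oo) => i j; exact: smooth_on_DxV. Qed.

Lemma smooth_on_adjDxV i j : smooth_on Omega (fun z => \adj (DxV V z) i j).
Proof. by apply: (smooth_on_adj Oo) => a b; exact: smooth_on_DxV. Qed.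

Lemma diff_family z w : Omega z -> 'd V z (w, 0) = DxV V z *m w.
Proof.
move=> Oz; apply/matrixP => i j; rewrite (ord1 j) -diff_coord; last exact: family_differentiable.
rewrite diff_pair_expand; last exact: (sV i [::]).
rewrite mul0r addr0 mxE; apply: eq_bigr => k _.
by rewrite DxV_entry // mulrC.
Qed.

Lemma family_increment z (eta : R) : Omega z -> 0 < eta ->
  exists2 rho : R, 0 < rho & forall w : 'cV[R]_n, `|w| < rho ->
    `|V (z + (w, 0)) - V z - DxV V z *m w| <= eta * `|w|.
Proof.
move=> Oz eta0.
have [||rho rho0 H] := @common_radius R 'I_n (fun i r => forall w : 'cV[R]_n, `|w| < r ->
    `|(V (z + (w, 0)) - V z - DxV V z *m w) i 0| <= eta * `|w|).
- by move=> i r s rs H w wr; apply: H; apply: lt_le_trans rs.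
- move=> i; have dV : differentiable (fun z => V z i 0) z by exact: (sV i [::]).
  have [rho rho0 H] := differentiable_bound dV eta0.
  exists rho => // w wr; have nw : `|(w, 0 : R)| = `|w|.
    by rewrite prod_normE /= normr0; apply/max_idPl.
  have := H (w, 0); rewrite nw => /(_ wr).
  by rewrite diff_coord ?diff_family ?mxE //; exact: family_differentiable.
exists rho => // w wr; apply: normr_cV_le => [|i]; first by rewrite mulr_ge0 // ltW.
exact: H.
Qed.

End Family.

Section Split.
Variables (R : realType) (m : nat) (M : 'M[R]_m) (Omega : set ('cV[R]_(1 + m) * R))
  (F : 'cV[R]_(1 + m) * R -> R) (G : 'cV[R]_(1 + m) * R -> 'cV[R]_m).
Hypotheses (Oo : open Omega) (O0 : Omega 0)
  (sF : smooth_on Omega F) (sG : smooth_on Omega G)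
  (DF0 : forall w, 'd F 0 w = 0) (DG0 : forall w, 'd G 0 w = 0).

Let V := split_family M F G.
Let i0 : 'I_(1 + m) := lshift m 0.

Lemma split_familyU z : V z i0 0 = F z.
Proof. by rewrite /V /split_family col_mxEu mxE mulr1n. Qed.

Lemma split_familyD z i : V z (rshift 1 i) 0 = (M *m dsubmx z.1 + G z) i 0.
Proof. by rewrite /V /split_family col_mxEd. Qed.

Lemma split_family_smooth i : smooth_on Omega (fun z => V z i 0).
Proof.
case: (split_ordP i) => j ->.
  rewrite (ord1 j); apply: (smooth_on_eq Oo _ sF) => z _.
  by rewrite -[lshift m 0]/i0 split_familyU.
have sMy : smooth_on Omega (fun z => \sum_k M j k * z.1 (rshift 1 k) 0).
  apply: (smooth_on_sum Oo) => k; apply: (smooth_onM Oo); first exact: smooth_on_cst.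
  exact: smooth_on_fst_coord.
apply: (smooth_on_eq Oo _ (smooth_onD Oo sMy (smooth_on_coord Oo j 0 sG))) => z _.
rewrite split_familyD !mxE; congr (_ + _); apply: eq_bigr => k _; by rewrite mxE.
Qed.

Lemma diff_split_familyD w i :
  'd (fun z => V z (rshift 1 i) 0) 0 w = (M *m dsubmx w.1) i 0.
Proof.
have dG : differentiable G 0 by exact: (sG [::]).
have dGi : differentiable (fun z => G z i 0) 0 by exact: (smooth_on_coord Oo i 0 sG [::]).
rewrite -deriveE; last exact: (split_family_smooth _ [::]).
have -> : (fun z => V z (rshift 1 i) 0) =
   (\sum_l (fun z : 'cV[R]_(1 + m) * R => M i l * z.1 (rshift 1 l) 0)) + (fun z => G z i 0).
  apply/funext => z; rewrite split_familyD !mxE !fctE fct_sumE; congr (_ + _).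
  by apply: eq_bigr => l _; rewrite mxE.
have dl l : is_derive 0 w (fun z : 'cV[R]_(1 + m) * R => M i l * z.1 (rshift 1 l) 0)
    (M i l * w.1 (rshift 1 l) 0).
  by have h := derive_coord (rshift 1 l) 0 w; exact: (@is_deriveZ _ _ _ _ (M i l)).
rewrite deriveD; [|exact: derivable_sum|exact: diff_derivable].
rewrite derive_sum // deriveE // diff_coord // DG0 [in X in _ + X]mxE addr0 [RHS]mxE.
by apply: eq_bigr => l _; rewrite derive_val mxE.
Qed.

Lemma DxV_split0 : DxV V 0 = block_mx 0 0 0 M.
Proof.
have dF : differentiable F 0 by exact: (sF [::]).
apply/matrixP => i j; rewrite (DxV_entry split_family_smooth) //.
case: (split_ordP i) => k ->.
  rewrite (ord1 k) -[lshift m 0]/i0.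
  under eq_fun do rewrite split_familyU.
  rewrite deriveE // DF0 /i0; case: (split_ordP j) => l ->.
    by rewrite block_mxEul mxE.
  by rewrite block_mxEur mxE.
rewrite deriveE ?diff_split_familyD /=; last exact: (split_family_smooth _ [::]).
rewrite mxE; case: (split_ordP j) => l ->.
  rewrite block_mxEdl mxE big1 // => a _; by rewrite !mxE eq_rlshift mulr0.
rewrite block_mxEdr (bigD1 l) //= !mxE !eqxx mulr1 big1 ?addr0 // => a al.
by rewrite !mxE eq_rshift (negPf al) mulr0.
Qed.

Lemma detDxV_split0 : detDxV V 0 = 0.
Proof. by rewrite /detDxV DxV_split0 det_lblock det0 mul0r. Qed.

Lemma adjDxV_split0 : \adj (DxV V 0) i0 i0 = \det M.
Proof.
rewrite DxV_split0 mxE /cofactor /= addn0 expr0 mul1r; congr (\det _).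
have lr k : lift i0 k = rshift 1 k by apply/val_inj.
by apply/matrixP => i j; rewrite mxE mxE !lr block_mxEdr.
Qed.

(** Cramer's rule in differential form: w is a displacement along which the y
    components of V do not change, so \adj A *m (V (z + w) - V z) only involves
    the increment of F, while \adj A *m A is the scalar matrix of \det A. *)
Lemma coord_increment (z : 'cV[R]_(1 + m) * R) (eta : R) : Omega z -> 0 < eta ->
  exists2 rho : R, 0 < rho & forall w : 'cV[R]_(1 + m), `|w| < rho ->
    (forall i, V (z + (w, 0)) (rshift 1 i) 0 = V z (rshift 1 i) 0) ->
    `|\adj (DxV V z) i0 i0 * (F (z + (w, 0)) - F z) - detDxV V z * w i0 0| <= eta * `|w|.
Proof.
move=> Oz eta0; set A := DxV V z.
have [c c0 cA] := mulmx_bound (\adj A).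
have [|rho rho0 H] := family_increment split_family_smooth Oz (_ : 0 < eta / c).
  by rewrite divr_gt0.
exists rho => // w wr Veq.
have -> : \adj A i0 i0 * (F (z + (w, 0)) - F z) - detDxV V z * w i0 0 =
   (\adj A *m (V (z + (w, 0)) - V z - A *m w)) i0 0.
  have subE (X Y : 'cV[R]_(1 + m)) k : (X - Y) k 0 = X k 0 - Y k 0 by rewrite !mxE.
  rewrite mulmxBr mulmxA mul_adj_mx mul_scalar_mx subE [(_ *: w) i0 0]mxE.
  congr (_ - _); rewrite [RHS]mxE (bigD1 i0) //= big1 ?addr0 => [|k ki0].
    by rewrite subE !split_familyU.
  rewrite subE; move: ki0; case: (split_ordP k) => l ->.
    by rewrite (ord1 l) eqxx.
  by rewrite Veq subrr mulr0.
apply: le_trans (normr_cV_coord _ _) _; apply: le_trans (cA _) _.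
apply: le_trans (_ : c * (eta / c * `|w|) <= _).
  by rewrite ler_wpM2l ?(ltW c0) // H.
by rewrite mulrA mulrCA mulfV ?mulr1 // gt_eqF.
Qed.

End Split.

(** * The branch y = g(u, e) *)

Section SmallLipschitz.
Variables (R : realType) (n p : nat) (Omega : set ('cV[R]_n * R))
  (G : 'cV[R]_n * R -> 'cV[R]_p).
Hypotheses (Oo : open Omega) (O0 : Omega 0) (sG : smooth_on Omega G).
Hypothesis (DG0 : forall w, 'd G 0 w = 0).

Lemma small_lipschitz (eta : R) : 0 < eta ->
  exists2 rho : R, 0 < rho & forall z1 z2, `|z1| < rho -> `|z2| < rho ->
    `|G z1 - G z2| <= eta * `|z1 - z2|.
Proof.
move=> eta0.
have [||rho rho0 H] := @common_radius R 'I_p (fun i r => forall z1 z2, `|z1| < r -> `|z2| < r ->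
    `|(G z1 - G z2) i 0| <= eta * `|z1 - z2|).
- by move=> i r s rs H z1 z2 z1r z2r; apply: H; apply: lt_le_trans rs.
- move=> i; have [rho rho0 H] := strict_differentiability Oo O0 (smooth_on_coord Oo i 0 sG) eta0.
  exists rho => // z1 z2 z1r z2r; have := H z1 z2 z1r z2r.
  by rewrite diff_coord ?DG0 ?[(0 : 'cV__) _ _]mxE ?subr0 ?mxE //; exact: (sG [::]).
exists rho => // z1 z2 z1r z2r; apply: normr_cV_le => [|i]; last exact: H.
by rewrite mulr_ge0 // ltW.
Qed.

Lemma quadratic_line (v : 'cV[R]_n * R) (eta : R) : G 0 = 0 -> 0 < eta ->
  exists2 rho : R, 0 < rho & forall t : R, `|t| < rho ->
    `|G (t *: v) - (t ^+ 2 / 2) *: 'D_v ('D_v G) 0| <= eta * t ^+ 2.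
Proof.
move=> G0 eta0.
have [||rho rho0 H] := @common_radius R 'I_p (fun i r => forall t : R, `|t| < r ->
    `|(G (t *: v) - (t ^+ 2 / 2) *: 'D_v ('D_v G) 0) i 0| <= eta * t ^+ 2).
- by move=> i r s rs H t tr; apply: H; apply: lt_le_trans rs.
- move=> i; have sGi := smooth_on_coord Oo i 0 sG.
  have dGv z : Omega z -> derivable G z v.
    by move=> Oz; apply: diff_derivable; exact: (sG [::]).
  have [rho rho0 H] := taylor2_line v Oo O0 sGi eta0.
  exists rho => // t tr; have := H t tr.
  have D1 z : Omega z -> 'D_v (fun z => G z i 0) z = ('D_v G z) i 0.
    by move=> Oz; rewrite derive_mx ?mxE //; exact: dGv.
  have -> : 'D_v ('D_v (fun z => G z i 0)) 0 = 'D_v ('D_v G) 0 i 0.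
    rewrite (_ : 'D_v ('D_v (fun z => G z i 0)) 0 = 'D_v (fun z => 'D_v G z i 0) 0).
      by rewrite [in RHS]derive_mx ?mxE //; apply: diff_derivable; exact: (sG [:: v]).
    by apply: (@foldr_derive_eq _ _ Omega Oo _ _ _ [:: v]).
  rewrite D1 // deriveE; last exact: (sG [::]).
  by rewrite DG0 G0 !mxE mulr0 !subr0.
exists rho => // t tr; apply: normr_cV_le => [|i]; last exact: H.
by rewrite mulr_ge0 ?sqr_ge0 // ltW.
Qed.

End SmallLipschitz.

Section Implicit.
Variables (R : realType) (m : nat) (M : 'M[R]_m) (Omega : set ('cV[R]_(1 + m) * R))
  (G : 'cV[R]_(1 + m) * R -> 'cV[R]_m).
Hypotheses (Oo : open Omega) (O0 : Omega 0) (sG : smooth_on Omega G).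
Hypotheses (Mu : M \in unitmx) (G0 : G 0 = 0) (DG0 : forall w, 'd G 0 w = 0).

(** Uniqueness turns small zeros of V into points of the branch; the Lipschitz
    bound stands in for the differentiability of g. *)
Definition implicit_branch (g : R -> R -> 'cV[R]_m) (r : R) :=
 [/\ forall u e, `|u| <= r -> `|e| <= r ->
       `|g u e| <= r /\ M *m g u e + G (pt u (g u e) e) = 0,
     forall u e y, `|u| <= r -> `|e| <= r -> `|y| <= r ->
       M *m y + G (pt u y e) = 0 -> y = g u e &
     forall u1 e1 u2 e2, `|u1| <= r -> `|e1| <= r -> `|u2| <= r -> `|e2| <= r ->
       `|g u1 e1 - g u2 e2| <= Num.max `|u1 - u2| `|e1 - e2| ].

(** The map y |-> - M^-1 G(u, y, e) contracts by 1/2 near the origin.  Comparing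
    the fixed point equations at two parameters bounds the displacement of y by
    half the maximum of all displacements, hence by that of the parameters. *)
Lemma implicit_branch_exists (r0 : R) : 0 < r0 ->
  exists g, exists2 r : R, 0 < r < r0 & implicit_branch g r.
Proof.
move=> r00; have [c c0 cM] := mulmx_bound (invmx M).
have eta0 : 0 < (2 * c)^-1 by rewrite invr_gt0 mulr_gt0.
have [rho rho0 lipG] := small_lipschitz Oo O0 sG DG0 eta0.
pose r := Num.min r0 rho / 2.
have mr : 0 < Num.min r0 rho by rewrite lt_min r00 rho0.
have r_gt0 : 0 < r by rewrite divr_gt0.
have [rr0 rrho] : r < r0 /\ r < rho.
  have : Num.min r0 rho <= r0 /\ Num.min r0 rho <= rho by rewrite !ge_min !lexx orbT.
  have : Num.min r0 rho = 2 * r by rewrite /r; field.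
  by move=> -> [? ?]; split; lra.
pose N u e y := - (invmx M *m G (pt u y e)).
have Nlip u1 e1 y1 u2 e2 y2 : `|pt u1 y1 e1| <= r -> `|pt u2 y2 e2| <= r ->
    `|N u1 e1 y1 - N u2 e2 y2| <= 2^-1 * `|pt u1 y1 e1 - pt u2 y2 e2|.
  move=> z1 z2.
  have -> : N u1 e1 y1 - N u2 e2 y2 = - (invmx M *m (G (pt u1 y1 e1) - G (pt u2 y2 e2))).
    by rewrite /N mulmxBr opprB opprK addrC.
  rewrite normrN.
  apply: le_trans (cM _) _; rewrite -ler_pdivlMl //.
  apply: le_trans (lipG _ _ (le_lt_trans z1 rrho) (le_lt_trans z2 rrho)) _.
  by rewrite mulrA invfM [c^-1 * _]mulrC.
have NE u e y : (M *m y + G (pt u y e) = 0) <-> (y = N u e y).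
  rewrite /N; split=> [/eqP|yE].
    rewrite addr_eq0 => /eqP My; rewrite -mulmxN -My mulKmx //.
  by rewrite {1}yE mulmxN mulKVmx // addNr.
have sol u e : exists y, `|u| <= r -> `|e| <= r -> `|y| <= r /\ y = N u e y.
  have [ur|] := boolP (`|u| <= r); last by exists 0.
  have [er|] := boolP (`|e| <= r); last by exists 0.
  have [|||y yr yN] := @fixed_point_in_ball R _ (N u e) r.
  - exact: ltW.
  - move=> y yr; have := @Nlip u e y 0 0 0.
    rewrite pt0 normr0 norm_pt_le ur er yr => /(_ isT (ltW r_gt0)).
    rewrite {2}/N pt0 G0 mulmx0 oppr0 !subr0 => /le_trans; apply.
    apply: (@le_trans _ _ (2^-1 * r)); last by lra.
    by rewrite ler_wpM2l ?invr_ge0 // norm_pt_le ur er yr.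
  - move=> y1 y2 y1r y2r; have := @Nlip u e y1 u e y2.
    rewrite !norm_pt_le ur er y1r y2r => /(_ isT isT) /le_trans; apply.
    rewrite ptB !subrr ler_wpM2l ?invr_ge0 // norm_pt_le normr0 !lexx.
    by rewrite normr_ge0.
  - by exists y.
have {}sol (p : R * R) : exists y, `|p.1| <= r -> `|p.2| <= r -> `|y| <= r /\ y = N p.1 p.2 y.
  exact: sol.
have [g gP] := choice sol.
have lip u1 e1 y1 u2 e2 y2 : `|u1| <= r -> `|e1| <= r -> `|u2| <= r -> `|e2| <= r ->
    `|y1| <= r -> `|y2| <= r -> y1 = N u1 e1 y1 -> y2 = N u2 e2 y2 ->
    `|y1 - y2| <= Num.max `|u1 - u2| `|e1 - e2|.
  move=> u1r e1r u2r e2r y1r y2r E1 E2.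
  have := @Nlip u1 e1 y1 u2 e2 y2; rewrite !norm_pt_le u1r e1r y1r u2r e2r y2r.
  rewrite -E1 -E2 ptB norm_pt => /(_ isT isT).
  have : 0 <= `|y1 - y2| by [].
  have : 0 <= `|u1 - u2| by [].
  have : 0 <= `|e1 - e2| by [].
  move: `|y1 - y2| `|u1 - u2| `|e1 - e2| => a b d d0 b0 a0.
  rewrite !maxEle; do !case: ifP; move=> *; lra.
exists (fun u e => g (u, e)), r; first by rewrite r_gt0.
split.
- by move=> u e ur er; have [gr /NE] := gP (u, e) ur er.
- move=> u e y ur er yr /NE yN; have [gr gN] := gP (u, e) ur er.
  apply/eqP; rewrite -subr_eq0 -normr_le0.
  have := @lip u e y u e (g (u, e)) ur er ur er yr gr yN gN.
  by rewrite !subrr normr0 maxxx.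
- move=> u1 e1 u2 e2 u1r e1r u2r e2r.
  have [g1 g1N] := gP (u1, e1) u1r e1r; have [g2 g2N] := gP (u2, e2) u2r e2r.
  exact: lip.
Qed.

Variables (g : R -> R -> 'cV[R]_m) (r : R).
Hypotheses (r_gt0 : 0 < r) (gP : implicit_branch g r).

Lemma implicit_branch0 : g 0 0 = 0.
Proof.
have [_ gU _] := gP; apply/esym/gU; rewrite ?normr0 ?(ltW r_gt0) //.
by rewrite mulmx0 add0r pt0.
Qed.

Lemma implicit_branch_le u e : `|u| <= r -> `|e| <= r -> `|g u e| <= Num.max `|u| `|e|.
Proof.
move=> ur er; have [_ _ gL] := gP; have := gL u e 0 0 ur er.
by rewrite normr0 implicit_branch0 !subr0; apply; exact: ltW.
Qed.

(** From y = - M^-1 G(u, y, e): moving y and e away from 0 changes G by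
    o(|y| + |e|), and G(u, 0, 0) = (u^2 / 2) G_uu + o(u^2).  This first gives
    y = O(u^2 + |e|), which then improves the error term to o(u^2 + |e|). *)
Lemma implicit_branch_expansion (eta : R) : 0 < eta ->
  exists2 rho : R, 0 < rho & forall u e, `|u| < rho -> `|e| < rho ->
    `|g u e + (u ^+ 2 / 2) *: (invmx M *m duu G 0)| <= eta * (u ^+ 2 + `|e|).
Proof.
move=> eta0; have [c c0 cM] := mulmx_bound (invmx M).
set H := duu G 0; set K := `|invmx M *m H|.
have K0 : 0 <= K by rewrite /K.
(* The first bound serves the final estimate, the second absorbs the |y| on the
   right-hand side into the left-hand side. *)
pose eta1 := Num.min (eta / (2 * (c * (K + 2)))) ((2 * c)^-1).
have cK : 0 < c * (K + 2) by rewrite mulr_gt0 // ltr_wpDl.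
have eta10 : 0 < eta1.
  have d1 : 0 < 2 * (c * (K + 2)) by rewrite pmulr_rgt0.
  by rewrite lt_min divr_gt0 // invr_gt0 pmulr_rgt0.
have [e1 e2] : eta1 <= eta / (2 * (c * (K + 2))) /\ eta1 <= (2 * c)^-1.
  by rewrite /eta1 !ge_min !lexx orbT.
have {}e1 : 2 * (c * eta1 * (K + 2)) <= eta.
  have -> : 2 * (c * eta1 * (K + 2)) = eta1 * (2 * (c * (K + 2))) by ring.
  by rewrite -ler_pdivlMr // pmulr_rgt0.
have {}e2 : c * eta1 <= 2^-1.
  by rewrite -ler_pdivlMl // -invfM mulrC.
have [rho1 rho10 lipG] := small_lipschitz Oo O0 sG DG0 eta10.
have [rho2 rho20 quadG] := quadratic_line Oo O0 sG DG0 (u_dir R m) G0 eta10.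
exists (Num.min r (Num.min rho1 rho2)); first by rewrite !lt_min r_gt0 rho10 rho20.
move=> u e; rewrite !lt_min => /and3P[ur u1 u2] /and3P[er ee1 _].
have [gS _ _] := gP; have [gr gE] := gS u e (ltW ur) (ltW er).
have gle := implicit_branch_le (ltW ur) (ltW er).
set y := g u e in gr gE gle *.
have yrho1 : `|y| < rho1 by apply: le_lt_trans gle _; rewrite gt_max u1 ee1.
have uE : u *: u_dir R m = pt u 0 0 by rewrite u_dirE ptZ mulr1 mulr0 scaler0.
have := quadG u u2; rewrite uE -/(duu G 0) -/H => q.
have := lipG (pt u y e) (pt u 0 0); rewrite !norm_pt_lt u1 yrho1 ee1 !normr0 rho10.
move=> /(_ isT isT); rewrite ptB !subrr !subr0 norm_pt normr0.
rewrite [Num.max 0 _]max_r // => l.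
have main : `|y + (u ^+ 2 / 2) *: (invmx M *m H)| <= c * eta1 * (u ^+ 2 + `|y| + `|e|).
  have -> : y + (u ^+ 2 / 2) *: (invmx M *m H) = - (invmx M *m
     ((G (pt u y e) - G (pt u 0 0)) + (G (pt u 0 0) - (u ^+ 2 / 2) *: H))).
    move/eqP: gE; rewrite addr_eq0 => /eqP gE.
    rewrite addrA subrK mulmxBr -scalemxAr opprB addrC; congr (_ + _).
    by rewrite -mulmxN -gE mulKmx.
  rewrite normrN; apply: le_trans (cM _) _; rewrite -mulrA ler_wpM2l ?(ltW c0) //.
  have -> : eta1 * (u ^+ 2 + `|y| + `|e|) = eta1 * (`|y| + `|e|) + eta1 * u ^+ 2 by ring.
  apply: le_trans (ler_normD _ _) _; apply: lerD => //.
  apply: le_trans l _; rewrite ler_wpM2l ?(ltW eta10) // ge_max lerDl lerDr.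
  by rewrite !normr_ge0.
have yK : `|y| <= K * u ^+ 2 + 2 * (c * eta1 * (u ^+ 2 + `|e|)).
  have ytri : `|y| <= `|y + (u ^+ 2 / 2) *: (invmx M *m H)| + u ^+ 2 / 2 * K.
    rewrite -{1}[y](addrK ((u ^+ 2 / 2) *: (invmx M *m H))).
    apply: le_trans (ler_normB _ _) _; rewrite lerD2l normrZ ger0_norm //.
    by rewrite divr_ge0 ?sqr_ge0.
  have y2 : c * eta1 * `|y| <= 2^-1 * `|y| by rewrite ler_wpM2r.
  have := sqr_ge0 u; rewrite !mulrDr in main *; lra.
apply: le_trans main _.
have u20 := sqr_ge0 u; have e0 : 0 <= `|e| by [].
have ce0 : 0 <= c * eta1 by rewrite mulr_ge0 ?ltW.
have step : u ^+ 2 + `|y| + `|e| <= 2 * ((K + 2) * (u ^+ 2 + `|e|)).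
  have : 2 * (c * eta1 * (u ^+ 2 + `|e|)) <= u ^+ 2 + `|e|.
    have : c * eta1 * (u ^+ 2 + `|e|) <= 2^-1 * (u ^+ 2 + `|e|).
      by rewrite ler_wpM2r // addr_ge0.
    lra.
  have Ku : 0 <= K * u ^+ 2 by rewrite mulr_ge0.
  have Ke : 0 <= K * `|e| by rewrite mulr_ge0.
  lra.
apply: le_trans (ler_wpM2l ce0 step) _.
have -> : c * eta1 * (2 * ((K + 2) * (u ^+ 2 + `|e|))) =
  2 * (c * eta1 * (K + 2)) * (u ^+ 2 + `|e|) by ring.
by rewrite ler_wpM2r // addr_ge0.
Qed.

End Implicit.

(** * Expansions along the branch *)

Lemma ler_dist_chain (R : realFieldType) (a b c d e1 e2 e3 : R) :
  `|a - b| <= e1 -> `|b - c| <= e2 -> `|c - d| <= e3 -> `|a - d| <= e1 + e2 + e3.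
Proof. by rewrite !ler_norml => /andP[? ?] /andP[? ?] /andP[? ?]; apply/andP; split; lra. Qed.

Section Branch.
Variables (R : realType) (m : nat) (M : 'M[R]_m) (Omega : set ('cV[R]_(1 + m) * R))
  (G : 'cV[R]_(1 + m) * R -> 'cV[R]_m).
Hypotheses (Oo : open Omega) (O0 : Omega 0) (sG : smooth_on Omega G).
Hypotheses (Mu : M \in unitmx) (G0 : G 0 = 0) (DG0 : forall w, 'd G 0 w = 0).
Variables (g : R -> R -> 'cV[R]_m) (r : R).
Hypotheses (r_gt0 : 0 < r) (gP : implicit_branch M G g r).

(** The coefficient of u^2 / 2 is the second derivative of h along the curve
    u |-> (u, - (u^2 / 2) M^-1 G_uu, 0). *)
Lemma expansion_along_branch (h : 'cV[R]_(1 + m) * R -> R) (eta : R) :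
  smooth_on Omega h -> 0 < eta ->
  exists2 rho : R, 0 < rho & forall u e, `|u| < rho -> `|e| < rho ->
    `|h (pt u (g u e) e) - (h 0 + u * 'D_(u_dir R m) h 0 + e * 'D_(0, 1) h 0
       + u ^+ 2 / 2 * (duu h 0 - 'd h 0 (y_dir (invmx M *m duu G 0))))|
    <= eta * (u ^+ 2 + `|e|).
Proof.
move=> sh eta0; set v := invmx M *m duu G 0.
have dh : differentiable h 0 by exact: (sh [::]).
have [k k0 hk] := linear_lipschitz (diff_continuous dh).
pose K := `|v|; have K0 : 0 <= K by rewrite /K.
have K2 : 0 < 2 * (K + 2) by rewrite pmulr_rgt0 // ltr_wpDl.
have eta10 : 0 < eta / (2 * (K + 2)) by rewrite divr_gt0.
have eta20 : 0 < eta / (2 * k) by rewrite divr_gt0 // pmulr_rgt0.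
set eta1 := eta / _ in eta10; set eta2 := eta / _ in eta20.
have [rho1 rho10 H1] := strict_differentiability Oo O0 sh eta10.
have [rho2 rho20 H2] := taylor2_line (u_dir R m) Oo O0 sh eta10.
have [rho3 rho30 H3] := implicit_branch_expansion Oo O0 sG Mu G0 DG0 r_gt0 gP eta20.
have [rho4 rho40 H4] := implicit_branch_expansion Oo O0 sG Mu G0 DG0 r_gt0 gP ltr01.
exists (Num.min (Num.min r rho1) (Num.min rho2 (Num.min rho3 rho4))).
  by rewrite !lt_min r_gt0 rho10 rho20 rho30.
move=> u e; rewrite !lt_min => /and3P[/andP[ur u1] u2 /andP[u3 u4]].
move=> /and3P[/andP[er e1] _ /andP[e3 e4]].
have := H3 u e u3 e3; have := H4 u e u4 e4.
have gle := implicit_branch_le G0 r_gt0 gP (ltW ur) (ltW er).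
rewrite -/v; move: (g u e) gle => y gle y4 y3.
have y1 : `|y| < rho1 by apply: le_lt_trans gle _; rewrite gt_max u1 e1.
have := H1 (pt u y e) (pt u 0 0); rewrite !norm_pt_lt u1 y1 e1 !normr0 rho10.
move=> /(_ isT isT); rewrite ptB subrr !subr0 norm_pt normr0 [Num.max 0 _]max_r // => {}H1.
have uE : u *: u_dir R m = pt u 0 0 by rewrite u_dirE ptZ mulr1 mulr0 scaler0.
have {}H2 := H2 u u2; rewrite uE -/(duu h) in H2.
have u20 := sqr_ge0 u; have e0 : 0 <= `|e| by [].
have yK : `|y| + `|e| + u ^+ 2 <= (K + 2) * (u ^+ 2 + `|e|).
  have : `|y| <= `|y + (u ^+ 2 / 2) *: v| + u ^+ 2 / 2 * K.
    rewrite -{1}[y](addrK ((u ^+ 2 / 2) *: v)).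
    apply: le_trans (ler_normB _ _) _; rewrite lerD2l normrZ ger0_norm //.
    by rewrite divr_ge0 ?sqr_ge0.
  have Ku : 0 <= K * u ^+ 2 by rewrite mulr_ge0.
  have Ke : 0 <= K * `|e| by rewrite mulr_ge0.
  by move=> yy; lra.
have dE : 'd h 0 (pt 0 y e) = 'd h 0 (y_dir (y + (u ^+ 2 / 2) *: v))
    - u ^+ 2 / 2 * 'd h 0 (y_dir v) + e * 'D_(0, 1) h 0.
  rewrite deriveE //.
  have -> : pt 0 y e = y_dir (y + (u ^+ 2 / 2) *: v) - (u ^+ 2 / 2) *: y_dir v + e *: (0, 1).
    have -> : (0, 1) = pt 0 0 1 :> 'cV[R]_(1 + m) * R by congr (_, _); rewrite raddf0 col_mx0.
    by rewrite !y_dirE !ptZ ptB ptD !mulr0 !scaler0 !subr0 !addr0 add0r mulr1 addrK.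
  by rewrite linearD linearB !linearZ.
have dk : `|'d h 0 (y_dir (y + (u ^+ 2 / 2) *: v))| <= k * (eta2 * (u ^+ 2 + `|e|)).
  apply: le_trans (hk _) _; rewrite ler_wpM2l ?(ltW k0) //; apply: le_trans y3.
  by rewrite y_dirE norm_pt !normr0 [Num.max 0 _]max_r // max_l.
move: dE dk H1 H2 yK; rewrite -/(duu h 0).
move: ('d h 0 (pt 0 y e)) ('d h 0 (y_dir (y + (u ^+ 2 / 2) *: v))) ('d h 0 (y_dir v)) => A B C'.
move: (h (pt u y e)) (h (pt u 0 0)) (h 0) ('D_(u_dir R m) h 0) ('D_(0, 1) h 0) (duu h 0).
move=> h1 h2 h3 Du De Duu -> dk H1 H2 yK.
have H1' : `|h1 - (h2 + (B - u ^+ 2 / 2 * C' + e * De))| <= eta1 * (`|y| + `|e|).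
  rewrite opprD addrA; apply: le_trans H1 _; rewrite ler_wpM2l ?(ltW eta10) //.
  by rewrite ge_max lerDl lerDr !normr_ge0.
have -> : eta * (u ^+ 2 + `|e|) = eta1 * ((K + 2) * (u ^+ 2 + `|e|)) + k * (eta2 * (u ^+ 2 +
    `|e|)).
  by rewrite /eta1 /eta2; field; rewrite !gt_eqF // ltr_wpDl.
apply: (@le_trans _ _ (eta1 * (`|y| + `|e|) + eta1 * u ^+ 2 + k * (eta2 * (u ^+ 2 + `|e|)))).
  apply: (@ler_dist_chain _ _ (h2 + (B - u ^+ 2 / 2 * C' + e * De))
     (h3 + u * Du + u ^+ 2 / 2 * Duu + (B - u ^+ 2 / 2 * C' + e * De))) => //.
    by rewrite opprD addrACA subrr addr0 !opprD !addrA.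
  apply: le_trans dk; rewrite le_eqVlt; apply/orP; left; apply/eqP.
  by congr (`|_|); ring.
by rewrite lerD2r -mulrDr ler_wpM2l ?(ltW eta10).
Qed.

Lemma branch_on_axis : exists C : R, 0 < C /\
  exists2 rho : R, 0 < rho & forall e : R, `|e| < rho -> `|g 0 e| <= C * e ^+ 2.
Proof.
have [c c0 cM] := mulmx_bound (invmx M).
have eta0 : 0 < (2 * c)^-1 by rewrite invr_gt0 mulr_gt0.
have [rho1 rho10 lipG] := small_lipschitz Oo O0 sG DG0 eta0.
have [rho2 rho20 quadG] := quadratic_line Oo O0 sG DG0 (0, 1) G0 ltr01.
pose C := 1 + 2^-1 * `|'D_(0, 1) ('D_(0, 1) G) (0 : 'cV[R]_(1 + m) * R)|.
have C0 : 0 < C by rewrite ltr_wpDr // mulr_ge0.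
exists (2 * (c * C)); split; first by rewrite !mulr_gt0.
exists (Num.min r (Num.min rho1 rho2)); first by rewrite !lt_min r_gt0 rho10 rho20.
move=> e; rewrite !lt_min => /and3P[er e1 e2].
have r0 : `|0 : R| <= r by rewrite normr0 ltW.
have gle := implicit_branch_le G0 r_gt0 gP r0 (ltW er).
have [gS _ _] := gP; have [_ gE] := gS 0 e r0 (ltW er).
move: (g 0 e) gle gE => y gle gE.
have y1 : `|y| < rho1 by apply: le_lt_trans gle _; rewrite normr0 max_r.
have ptE1 : pt 0 0 e = e *: (0, 1) :> 'cV[R]_(1 + m) * R.
  by congr (_, _); rewrite /= ?raddf0 ?col_mx0 ?scaler0 // [_ *: _]mulr1.
have Ge : `|G (pt 0 0 e)| <= C * e ^+ 2.
  rewrite ptE1 -[G _](subrK ((e ^+ 2 / 2) *: 'D_(0, 1) ('D_(0, 1) G) 0)).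
  apply: le_trans (ler_normD _ _) _; rewrite mulrDl; apply: lerD; first exact: quadG.
  rewrite normrZ ger0_norm ?divr_ge0 ?sqr_ge0 // le_eqVlt; apply/orP; left; apply/eqP.
  by rewrite mulrAC [_ * e ^+ 2]mulrC -mulrA [_^-1 * _]mulrC mulrA.
have := lipG (pt 0 y e) (pt 0 0 e); rewrite !norm_pt_lt !normr0 rho10 y1 e1.
move=> /(_ isT isT); rewrite ptB !subrr subr0 norm_pt !normr0 [Num.max 0 _]max_r // max_l // => l.
have : `|y| <= c * ((2 * c)^-1 * `|y| + C * e ^+ 2).
  move/eqP: gE; rewrite addr_eq0 => /eqP gE.
  rewrite -{1}(mulKmx Mu y) gE mulmxN normrN; apply: le_trans (cM _) _.
  rewrite ler_wpM2l ?(ltW c0) // -[G _](subrK (G (pt 0 0 e))).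
  by apply: le_trans (ler_normD _ _) _; apply: lerD.
have -> : c * ((2 * c)^-1 * `|y| + C * e ^+ 2) = 2^-1 * `|y| + c * C * e ^+ 2.
  by field; rewrite gt_eqF.
by rewrite -!mulrA; lra.
Qed.

Lemma quadratic_at_axis (F : 'cV[R]_(1 + m) * R -> R) :
  smooth_on Omega F -> F 0 = 0 -> (forall w, 'd F 0 w = 0) ->
  exists C : R, 0 < C /\
  exists2 rho : R, 0 < rho & forall e : R, `|e| < rho -> `|F (pt 0 (g 0 e) e)| <= C * e ^+ 2.
Proof.
move=> sF F0 DF0; have [C1 [C10 [rho1 rho10 H1]]] := branch_on_axis.
have [rho2 rho20 lipF] := strict_differentiability Oo O0 sF ltr01.
have [rho3 rho30 quadF] := taylor2_line ((0, 1) : 'cV[R]_(1 + m) * R) Oo O0 sF ltr01.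
pose C := 1 + 2^-1 * `|'D_(0, 1) ('D_(0, 1) F) (0 : 'cV[R]_(1 + m) * R)|.
have C0 : 0 < C by rewrite ltr_wpDr // mulr_ge0.
exists (C1 + C); split; first by rewrite addr_gt0.
exists (Num.min (Num.min r rho1) (Num.min rho2 rho3)); first by rewrite !lt_min r_gt0 rho10 rho20.
move=> e; rewrite !lt_min => /andP[/andP[er e1] /andP[e2 e3]].
have r0 : `|0 : R| <= r by rewrite normr0 ltW.
have gle := implicit_branch_le G0 r_gt0 gP r0 (ltW er).
have := H1 e e1; move: (g 0 e) gle => y gle ye.
have y1 : `|y| < rho2 by apply: le_lt_trans gle _; rewrite normr0 max_r.
have ptE1 : pt 0 0 e = e *: (0, 1) :> 'cV[R]_(1 + m) * R.
  by congr (_, _); rewrite /= ?raddf0 ?col_mx0 ?scaler0 // [_ *: _]mulr1.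
have := lipF (pt 0 y e) (pt 0 0 e); rewrite !norm_pt_lt !normr0 rho20 y1 e2 DF0 subr0.
move=> /(_ isT isT); rewrite ptB !subrr subr0 norm_pt !normr0 [Num.max 0 _]max_r // max_l //
    mul1r => l.
have Fe : `|F (pt 0 0 e)| <= C * e ^+ 2.
  have := quadF e e3; rewrite -ptE1 F0 deriveE; last exact: (sF [::]).
  rewrite DF0 mulr0 !subr0 => q.
  rewrite -[F _](subrK (e ^+ 2 / 2 * 'D_(0, 1) ('D_(0, 1) F) 0)).
  apply: le_trans (ler_normD _ _) _; rewrite mulrDl; apply: lerD => //.
  rewrite normrM ger0_norm ?divr_ge0 ?sqr_ge0 // le_eqVlt; apply/orP; left; apply/eqP.
  by rewrite mulrAC [_ * e ^+ 2]mulrC -mulrA [_^-1 * _]mulrC mulrA.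
rewrite -[F _](subrK (F (pt 0 0 e))) mulrDl.
by apply: le_trans (ler_normD _ _) _; apply: lerD => //; apply: le_trans ye.
Qed.

End Branch.

(** * The reduced function and its derivative *)

Section Reduced.
Variables (R : realType) (m : nat) (M : 'M[R]_m) (Omega : set ('cV[R]_(1 + m) * R))
  (F : 'cV[R]_(1 + m) * R -> R) (G : 'cV[R]_(1 + m) * R -> 'cV[R]_m).
Hypotheses (Oo : open Omega) (O0 : Omega 0)
  (sF : smooth_on Omega F) (sG : smooth_on Omega G) (Mu : M \in unitmx)
  (F0 : F 0 = 0) (DF0 : forall w, 'd F 0 w = 0)
  (G0 : G 0 = 0) (DG0 : forall w, 'd G 0 w = 0).
Variables (g : R -> R -> 'cV[R]_m) (r : R).
Hypotheses (r_gt0 : 0 < r) (gP : implicit_branch M G g r)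
  (rO : forall z, `|z| <= r -> Omega z).

Let V := split_family M F G.
Let i0 : 'I_(1 + m) := lshift m 0.

Definition branch_pt u e := pt u (g u e) e.
Definition reduced u e := F (branch_pt u e).
Definition uu_cofactor z := \adj (DxV V z) i0 i0.

Lemma branch_pt_le u e : `|u| <= r -> `|e| <= r -> `|branch_pt u e| <= Num.max `|u| `|e|.
Proof.
move=> ur er; rewrite norm_pt_le (implicit_branch_le G0 r_gt0 gP ur er).
by rewrite !le_max !lexx orbT.
Qed.

Lemma branch_zero u e : `|u| <= r -> `|e| <= r ->
  (V (branch_pt u e) = 0) <-> (reduced u e = 0).
Proof.
move=> ur er; have [gS _ _] := gP; have [_ gE] := gS u e ur er; split=> [V0|f0].
  by have := split_familyU M F G (branch_pt u e); rewrite -/V V0 mxE /reduced => ->.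
rewrite /V /split_family -/(reduced u e) f0 /branch_pt /= col_mxKd gE.
by rewrite raddf0 col_mx0.
Qed.

Lemma zero_on_branch u y e : `|u| <= r -> `|e| <= r -> `|y| <= r ->
  V (pt u y e) = 0 -> y = g u e.
Proof.
move=> ur er yr V0; have [_ gU _] := gP; apply: gU => //.
have : dsubmx (V (pt u y e)) = 0 by rewrite V0 raddf0.
by rewrite /V /split_family col_mxKd /= col_mxKd.
Qed.

(** [coord_increment] applies to two points of the branch over the same e, and
    the Lipschitz bound on g makes o(w) an o of the increment of u. *)
Lemma reduced_derivative u e : `|u| < r -> `|e| <= r -> uu_cofactor (branch_pt u e) != 0 ->
  is_derive u 1 (reduced^~ e) (detDxV V (branch_pt u e) / uu_cofactor (branch_pt u e)).
Proof.
move=> ur er; set z := branch_pt u e; set c := uu_cofactor z; set D := detDxV V z => c0.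
have Oz : Omega z.
  by apply: rO; rewrite (le_trans (branch_pt_le (ltW ur) er)) // ge_max (ltW ur).
have ru : 0 < r - `|u| by rewrite subr_gt0.
have q : (fun h : R => h^-1 *: ((reduced^~ e \o shift u) (h *: 1) - reduced u e)) @ 0^' --> D / c.
  apply/cvgrPdist_le => eps eps0.
  have cp : 0 < `|c| by rewrite normr_gt0.
  have [|rho rho0 H] := coord_increment M Oo sF sG Oz (_ : 0 < eps * `|c|).
    by rewrite mulr_gt0.
  near=> h.
  have h0 : h != 0 by near: h; exact: nbhs_dnbhs_neq.
  have hrho : `|h| < rho by near: h; exact: dnbhs0_lt.
  have hru : `|h| < r - `|u| by near: h; exact: dnbhs0_lt.
  have uhr : `|u + h| <= r.
    by apply: le_trans (ler_normD _ _) _; rewrite addrC -lerBrDr ltW.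
  pose w : 'cV[R]_(1 + m) := col_mx h%:M (g (u + h) e - g u e).
  have wh : `|w| <= `|h|.
    have : `|pt h (g (u + h) e - g u e) 0| <= `|h|.
      have [_ _ gL] := gP; rewrite norm_pt_le lexx normr0 normr_ge0 andbT /=.
      apply: le_trans (gL _ _ _ _ uhr er (ltW ur) er) _.
      by rewrite subrr normr0 addrAC subrr add0r ge_max lexx normr_ge0.
    by rewrite /pt normr_pair_le => /andP[].
  have zw : z + (w, 0) = branch_pt (u + h) e.
    by rewrite /z /branch_pt ptD; congr (_, _); rewrite ?addr0 // [g u e + _]addrC subrK.
  have Vd i v : `|v| <= r -> V (branch_pt v e) (rshift 1 i) 0 = 0.
    move=> vr; have [gS _ _] := gP; have [_ gE] := gS v e vr er.
    by rewrite /V split_familyD /branch_pt /= col_mxKd gE mxE.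
  have := H w (le_lt_trans wh hrho); rewrite zw.
  move=> /(_ (fun i => etrans (Vd i _ uhr) (esym (Vd i _ (ltW ur))))).
  rewrite -/(uu_cofactor z) -/c -/D -/(reduced (u + h) e) -/(reduced u e).
  have -> : w (lshift m 0) 0 = h by rewrite /w col_mxEu mxE mulr1n.
  rewrite /= /shift /= [h *: 1]mulr1 [h + u]addrC.
  move: (reduced (u + h) e) (reduced u e) => f1 f2 Hw.
  have -> : D / c - h^-1 *: (f1 - f2) = - (c * (f1 - f2) - D * h) / (c * h).
    by rewrite /GRing.scale /=; field; rewrite c0 h0.
  rewrite normrM normrN normfV ler_pdivrMr ?normr_gt0 ?mulf_neq0 //.
  apply: le_trans Hw _; rewrite normrM mulrA ler_wpM2l // mulr_ge0 // ltW //.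
by split; [apply/cvg_ex; exists (D / c)|apply: cvg_lim].
Unshelve. all: by end_near. Qed.

(** At the origin D_xV is block diagonal with blocks 0 and M, so its uu cofactor
    is \det M; the rest is continuity. *)
Lemma uu_cofactor_near (eta : R) : 0 < eta ->
  exists2 rho : R, 0 < rho & forall u e, `|u| < rho -> `|e| < rho ->
    0 < uu_cofactor (branch_pt u e) / \det M /\
    `|(uu_cofactor (branch_pt u e))^-1 - (\det M)^-1| <= eta.
Proof.
move=> eta0.
have dM : \det M != 0 by rewrite -unitfE -unitmxE.
have c0 : uu_cofactor 0 = \det M by exact: (adjDxV_split0 M Oo O0 sF sG).
have cc : {for 0, continuous uu_cofactor}.
  apply: differentiable_continuous.
  exact: (smooth_on_adjDxV Oo (split_family_smooth M Oo sF sG) i0 i0 [::]).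
have p1 : \forall z \near (0 : 'cV[R]_(1 + m) * R), `|(uu_cofactor z)^-1 - (\det M)^-1| <= eta.
  have : (fun z => (uu_cofactor z)^-1) @ (0 :
      'cV[R]_(1 + m) * R) --> (uu_cofactor 0)^-1 by apply: cvgV => //; rewrite c0.
  by move=> /cvgrPdist_le/(_ _ eta0); apply: filterS => z; rewrite c0 distrC.
have p2 : \forall z \near (0 : 'cV[R]_(1 + m) * R), 0 < uu_cofactor z / \det M.
  have : (fun z => uu_cofactor z / \det M) @ (0 :
      'cV[R]_(1 + m) * R) --> uu_cofactor 0 / \det M by apply: cvgM => //; exact: cvg_cst.
  by rewrite c0 divff // => /cvgr_gt; apply.
have [rho rho0 H] := near0_radius (filterI p1 p2).
exists (Num.min r rho); first by rewrite lt_min r_gt0.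
move=> u e; rewrite !lt_min => /andP[ur u1] /andP[er e1].
have [|h1 h2] := H (branch_pt u e); last by split.
by apply: le_lt_trans (branch_pt_le (ltW ur) (ltW er)) _; rewrite gt_max u1.
Qed.

Let Delta := detDxV V.
Let Du := 'D_(u_dir R m) Delta 0.
Let De := 'D_(0, 1) Delta 0.
Let beta := duu Delta 0 - 'd Delta 0 (y_dir (invmx M *m duu G 0)).

Lemma Delta_smooth : smooth_on Omega Delta.
Proof. exact: (smooth_on_detDxV Oo (split_family_smooth M Oo sF sG)). Qed.

Lemma Delta_expansion (eta : R) : 0 < eta ->
  exists2 rho : R, 0 < rho & forall u e, `|u| < rho -> `|e| < rho ->
   `|Delta (branch_pt u e) - (u * Du + e * De + u ^+ 2 / 2 * beta)| <= eta * (u ^+ 2 + `|e|).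
Proof.
move=> eta0.
have [rho rho0 H] := expansion_along_branch Oo O0 sG Mu G0 DG0 r_gt0 gP Delta_smooth eta0.
exists rho => // u e ur er; have := H u e ur er.
by rewrite (_ : Delta 0 = 0) ?add0r //; exact: (detDxV_split0 M Oo O0 sF sG).
Qed.

Lemma slope_expansion (eta : R) : Du = 0 -> 0 < eta ->
  exists2 rho : R, 0 < rho & forall u e, `|u| < rho -> `|e| < rho ->
   `|Delta (branch_pt u e) / uu_cofactor (branch_pt u e) - (De / \det M * e + beta / (2 * \det
       M) * u ^+ 2)|
   <= eta * (u ^+ 2 + `|e|).
Proof.
move=> Du0 eta0.
have dM : \det M != 0 by rewrite -unitfE -unitmxE.
pose k := `|(\det M)^-1| + 1; have k0 : 0 < k by rewrite ltr_wpDl.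
pose K := `|De| + `|beta| + 1; have K0 : 0 < K by rewrite ltr_wpDl // addr_ge0.
have [|rho1 rho10 H1] := @Delta_expansion (eta / (2 * k)).
  by rewrite divr_gt0 // pmulr_rgt0.
have [|rho2 rho20 H2] := @uu_cofactor_near (Num.min 1 (eta / (2 * K))).
  by rewrite lt_min ltr01 divr_gt0 // pmulr_rgt0.
exists (Num.min rho1 rho2); first by rewrite lt_min rho10.
move=> u e; rewrite !lt_min => /andP[u1 u2] /andP[e1 e2].
have {}H1 := H1 u e u1 e1; have [_ H2'] := H2 u e u2 e2.
move: H1 H2'; rewrite Du0 mulr0 add0r le_min.
move: (Delta _) (uu_cofactor _) => D c H1 /andP[c1 c2].
set P := e * De + u ^+ 2 / 2 * beta in H1.
have u20 := sqr_ge0 u; have e0 : 0 <= `|e| by [].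
have PK : `|P| <= K * (u ^+ 2 + `|e|).
  apply: le_trans (ler_normD _ _) _;
      rewrite normrM [X in _ + X]normrM (@ger0_norm _ (u ^+ 2 / 2)) ?divr_ge0 //.
  have : 0 <= `|e| * `|beta| by rewrite mulr_ge0.
  have : 0 <= u ^+ 2 * `|De| by rewrite mulr_ge0.
  have : 0 <= u ^+ 2 * `|beta| by rewrite mulr_ge0.
  by rewrite /K; lra.
have -> : D / c - (De / \det M * e + beta / (2 * \det M) * u ^+ 2) =
    (D - P) * c^-1 + P * (c^-1 - (\det M)^-1).
  have -> : De / \det M * e + beta / (2 * \det M) * u ^+ 2 = P / \det M by rewrite /P; field.
  by ring.
have ck : `|c^-1| <= k.
  by rewrite -[c^-1](subrK (\det M)^-1) /k; apply: le_trans (ler_normD _ _) _;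
      rewrite addrC lerD2l.
apply: le_trans (ler_normD _ _) _; rewrite !normrM.
have -> : eta * (u ^+ 2 + `|e|) = eta / (2 * k) * (u ^+ 2 + `|e|) * k + K * (u ^+ 2 + `|e|) *
    (eta / (2 * K)).
  by field; rewrite !gt_eqF.
by apply: lerD; apply: ler_pM.
Qed.

End Reduced.

(** * Consequence of the non-vanishing index *)

Lemma normr_le_enorm (R : realType) n (x : 'cV[R]_n) : `|x| <= enorm x.
Proof.
apply: normr_cV_le => [|i]; first exact: sqrtr_ge0.
rewrite -sqrtr_sqr ler_wsqrtr // (bigD1 i) //= lerDl.
by apply: sumr_ge0 => j _; exact: sqr_ge0.
Qed.

(** A value omitted on the sphere is vacuously regular, and its fibre is empty. *)
Lemma index_missed_direction (R : realType) n (A : set 'cV[R]_n) (W : 'cV[R]_n -> 'cV[R]_n)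
    (z v : 'cV[R]_n) (d : int) (r : R) :
  index_of_zero A W z d -> 0 < r -> enorm v = 1 ->
  (forall x, enorm (x - z) <= r -> A x /\ (W x = 0 -> x = z)) ->
  (forall x, enorm (x - z) = r -> normalize W x <> v) -> d = 0.
Proof.
move=> [_ idx] r0 v1 Ar miss.
have fib0 : sphere_fiber (normalize W) z r v = set0.
  by apply/seteqP; split => // p [pr pv]; exact: (miss p).
have := idx r r0 Ar v v1; rewrite fib0 fsbig_set0 => <- //.
Qed.

Section Reduced.
Variables (R : realType) (m : nat) (M : 'M[R]_m) (Omega : set ('cV[R]_(1 + m) * R))
  (F : 'cV[R]_(1 + m) * R -> R) (G : 'cV[R]_(1 + m) * R -> 'cV[R]_m).
Hypotheses (Oo : open Omega) (O0 : Omega 0)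
  (sF : smooth_on Omega F) (sG : smooth_on Omega G) (Mu : M \in unitmx)
  (F0 : F 0 = 0) (DF0 : forall w, 'd F 0 w = 0)
  (G0 : G 0 = 0) (DG0 : forall w, 'd G 0 w = 0).
Variables (g : R -> R -> 'cV[R]_m) (r : R).
Hypotheses (r_gt0 : 0 < r) (gP : implicit_branch M G g r)
  (rO : forall z, `|z| <= r -> Omega z).

Let V := split_family M F G.
Let Delta := detDxV V.
Let Du : R := 'D_(u_dir R m) Delta 0.
Let De : R := 'D_(0, 1) Delta 0.
Let beta : R := duu Delta 0 - 'd Delta 0 (y_dir (invmx M *m duu G 0)).
Local Notation f := (reduced F g).

Lemma reduced0 : f 0 0 = 0.
Proof. by rewrite /reduced /branch_pt (implicit_branch0 G0 r_gt0 gP) pt0. Qed.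

(** The slope of f(., 0) is Delta / C with Delta = Du u + O(u^2), so it changes
    sign at 0, where f vanishes. *)
Lemma reduced_sign : Du != 0 ->
  exists2 rho : R, 0 < rho & forall u : R, `|u| < rho -> u != 0 -> 0 < f u 0 * (Du * \det M).
Proof.
move=> Du0; have dM : \det M != 0 by rewrite -unitfE -unitmxE.
have [rho1 rho10 H1] := Delta_expansion Oo O0 sF sG Mu DF0 G0 DG0 r_gt0 gP ltr01.
have [rho2 rho20 H2] := uu_cofactor_near Oo O0 sF sG Mu DF0 G0 DG0 r_gt0 gP ltr01.
pose K : R := 1 + `|beta|; have K0 : 0 < K by rewrite ltr_wpDr.
exists (Num.min (Num.min r rho1) (Num.min rho2 (`|Du| / K))).
  by rewrite !lt_min r_gt0 rho10 rho20 divr_gt0 // normr_gt0.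
pose df c := Delta (branch_pt g c 0) / uu_cofactor M F G (branch_pt g c 0).
have r0 : `|0 : R| <= r by rewrite normr0 ltW.
have slope (c : R) : `|c| < Num.min (Num.min r rho1) (Num.min rho2 (`|Du| / K)) ->
    is_derive c 1 (f^~ 0) (df c) /\ (c != 0 -> 0 < df c * c * (Du * \det M)).
  rewrite !lt_min => /andP[/andP[cr c1] /andP[c2 cK]].
  have n0 : `|0 : R| < rho2 by rewrite normr0.
  have [q _] := H2 c 0 c2 n0.
  split.
    apply: (reduced_derivative Oo sF sG G0 r_gt0 gP rO cr r0).
    by apply: contraTneq q => ->; rewrite mul0r ltxx.
  move=> cn0; rewrite /df; have := H1 c 0 c1; rewrite normr0 => /(_ rho10).
  rewrite mul0r addr0 addr0 mul1r -/Du -/beta -/Delta.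
  move: (Delta _) (uu_cofactor _ _ _ _) q => D k q H.
  have D0 : 0 < D * c * Du.
    have cDu : 0 < `|c| * `|Du| by rewrite mulr_gt0 ?normr_gt0.
    have h : `|D - c * Du| < `|c| * `|Du|.
      apply: (@le_lt_trans _ _ (K * `|c| ^+ 2)); last first.
        by rewrite expr2 mulrCA ltr_pM2l ?normr_gt0 // mulrC -ltr_pdivlMr.
      apply: (@le_trans _ _ (c ^+ 2 + c ^+ 2 / 2 * `|beta|)).
        have -> : D - c * Du = D - (c * Du + c ^+ 2 / 2 * beta) + c ^+ 2 / 2 * beta by ring.
        apply: le_trans (ler_normD _ _) _; apply: lerD => //.
        by rewrite normrM [`|_ / 2|]ger0_norm ?divr_ge0 ?sqr_ge0.
      rewrite real_normK ?num_real // /K mulrDl mul1r lerD2l [_ * c ^+ 2]mulrC.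
      by rewrite ler_wpM2r // ler_pdivrMr // ler_peMr ?sqr_ge0 // ler1n.
    have : `|(D - c * Du) * (c * Du)| < (c * Du) ^+ 2.
      rewrite normrM -(real_normK (num_real (c * Du))) expr2 ltr_pM2r normrM //.
    by rewrite ltr_norml => /andP[+ _]; lra.
  have kn0 : k != 0 by apply: contraTneq q => ->; rewrite mul0r ltxx.
  have -> : D / k * c * (Du * \det M) = D * c * Du * (k / \det M)^-1.
    by field; rewrite ?dM ?kn0.
  by rewrite mulr_gt0 ?invr_gt0.
move=> u ur u0.
have seg (c : R) : `|c| <= `|u| -> `|c| < Num.min (Num.min r rho1) (Num.min rho2 (`|Du| / K)).
  by move=> cu; apply: le_lt_trans ur.
case: (ltgtP 0 u) u0 => // [up|un] _.
  have [c /andP[c0 cu]|c /andP[c0 cu]] := @mean_value R (f^~ 0) df 0 u up.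
    by have [] := slope c (seg c _); rewrite // !ger0_norm // (le_trans c0).
  rewrite /= reduced0 !subr0 => ->.
  have cs : `|c| <= `|u| by rewrite !gtr0_norm // ltW.
  have [_ /(_ (lt0r_neq0 c0))] := slope c (seg c cs).
  by rewrite mulrAC pmulr_lgt0 // => h; rewrite mulrAC pmulr_lgt0.
have [c /andP[c0 cu]|c /andP[c0 cu]] := @mean_value R (f^~ 0) df u 0 un.
  by have [] := slope c (seg c _); rewrite // !ler0_norm ?lerN2 // (le_trans c0).
rewrite /= reduced0 !sub0r mulrN => /oppr_inj ->.
have cs : `|c| <= `|u| by rewrite !ltr0_norm // lerN2 ltW.
have [_ /(_ (ltr0_neq0 cu))] := slope c (seg c cs).
by rewrite mulrAC nmulr_lgt0 // => h; rewrite mulrAC nmulr_lgt0.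
Qed.

(** The omitted direction is - sg s e_1 with s = Du * \det M: where V points in a
    direction without y component, x lies on the branch, and there F has the sign
    of s. *)
Lemma index_forces_Du0 (d : int) :
  index_of_zero [set x | Omega (x, 0)] (fun x => V (x, 0)) 0 d -> d <> 0 -> Du = 0.
Proof.
move=> idx d0; apply/eqP; case: (eqVneq Du 0) => // Du0; exfalso; apply: d0.
have dM : \det M != 0 by rewrite -unitfE -unitmxE.
have [rho rho0 sgn] := reduced_sign Du0.
set s := Du * \det M in sgn.
have s0 : s != 0 by rewrite mulf_neq0.
pose a := Num.min r rho / 2.
have m0 : 0 < Num.min r rho by rewrite lt_min r_gt0.
have a0 : 0 < a by rewrite divr_gt0.
have [ar arho] : a <= r /\ a < rho.
  have : Num.min r rho <= r /\ Num.min r rho <= rho by rewrite !ge_min !lexx orbT.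
  have : Num.min r rho = 2 * a by rewrite /a; field.
  by move=> -> [? ?]; split; lra.
pose v : 'cV[R]_(1 + m) := col_mx (- Num.sg s)%:M 0.
have r00 : `|0 : R| <= r by rewrite normr0 ltW.
have curve (x : 'cV[R]_(1 + m)) : `|x| <= a -> dsubmx (V (x, 0)) = 0 -> x != 0 ->
    0 < V (x, 0) (lshift m 0) 0 * s.
  move=> xa Vy x0; have xE := ptE (x, 0); rewrite /= in xE.
  set u := x (lshift m 0) 0 in xE; set y := dsubmx x in xE.
  have /and3P[ua ya _] : [&& `|u| <= a, `|y| <= a & `|0 : R| <= a].
    by rewrite -norm_pt_le -xE normr_pair_le xa normr0 ltW.
  have yg : y = g u 0.
    have [_ gU _] := gP; apply: gU; rewrite ?(le_trans ua) ?(le_trans ya) //.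
    by rewrite -xE; move: Vy; rewrite /V /split_family col_mxKd.
  rewrite split_familyU xE yg -/(branch_pt g u 0) -/(f u 0); apply: sgn.
    exact: le_lt_trans arho.
  apply: contra_neq x0 => u0; move: xE; rewrite yg u0 (implicit_branch0 G0 r_gt0 gP) pt0.
  by case.
apply: (@index_missed_direction R _ _ _ _ v d a idx a0).
- rewrite /enorm big_split_ord /= big_ord1 [X in _ + X]big1 => [|i _].
    by rewrite col_mxEu mxE mulr1n sqrrN addr0 sqrtr_sqr normr_sg s0.
  by rewrite col_mxEd mxE expr0n.
- move=> x; rewrite subr0 => xa; have {}xa := le_trans (normr_le_enorm x) xa.
  split; first by apply: rO; rewrite normr_pair_le normr0 (le_trans xa ar) ltW.
  move=> Vx; apply/eqP; apply: contraT => x0.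
  by have := curve x xa; rewrite Vx raddf0 mxE mul0r ltxx => /(_ erefl x0).
- move=> x; rewrite subr0 => xa; rewrite /normalize => Vv.
  have xn : `|x| <= a by rewrite -xa normr_le_enorm.
  have x0 : x != 0.
    apply: contraTneq a0 => x0; rewrite -xa x0 /enorm big1 ?sqrtr0 ?ltxx // => i _.
    by rewrite mxE expr0n.
  set k := (enorm (V (x, 0)))^-1 in Vv.
  have k0 : 0 <= k by rewrite invr_ge0 sqrtr_ge0.
  have top : k * V (x, 0) (lshift m 0) 0 = - Num.sg s.
    by have := congr1 (fun w : 'cV_(1 + m) => w (lshift m 0) 0) Vv;
        rewrite /= [LHS]mxE [RHS]col_mxEu [RHS]mxE mulr1n.
  have kn0 : k != 0.
    apply/eqP => k00; move: top; rewrite k00 mul0r => /eqP.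
    by rewrite eq_sym oppr_eq0 sgr_eq0 (negPf s0).
  have Vy : dsubmx (V (x, 0)) = 0.
    have := congr1 dsubmx Vv; rewrite linearZ /= [RHS]col_mxKd => /eqP.
    by rewrite scaler_eq0 (negPf kn0) => /eqP.
  have := curve x xn Vy x0.
  have kp : 0 < k by rewrite lt_neqAle eq_sym kn0.
  by rewrite -(pmulr_rgt0 _ kp) mulrA top mulNr -normrEsg oppr_gt0 ltNge normr_ge0.
Qed.

End Reduced.

(** * From the reduced function to the bifurcation *)

Section Assembly.
Variables (R : realType) (m : nat) (M : 'M[R]_m) (Omega : set ('cV[R]_(1 + m) * R))
  (F : 'cV[R]_(1 + m) * R -> R) (G : 'cV[R]_(1 + m) * R -> 'cV[R]_m).
Hypotheses (Oo : open Omega) (O0 : Omega 0)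
  (sF : smooth_on Omega F) (sG : smooth_on Omega G) (Mu : M \in unitmx)
  (F0 : F 0 = 0) (DF0 : forall w, 'd F 0 w = 0)
  (G0 : G 0 = 0) (DG0 : forall w, 'd G 0 w = 0).

Let V := split_family M F G.
Let Delta := detDxV V.
Let Du : R := 'D_(u_dir R m) Delta 0.
Let De : R := 'D_(0, 1) Delta 0.
Let beta : R := duu Delta 0 - 'd Delta 0 (y_dir (invmx M *m duu G 0)).

(** The rows of DV w = 0 below the first read M w_y = 0, as DG vanishes. *)
Lemma transversality : Du = 0 -> propertyP2 V 0 0 -> De != 0.
Proof.
move=> Du0 [w [dVw w2 dDw]].
have sV := split_family_smooth M Oo sF sG.
have dV : differentiable V 0 := family_differentiable sV O0.
have wE := ptE w; set y := dsubmx w.1 in wE.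
have wy : y = 0.
  have h : M *m y = 0.
    apply/matrixP => i j; rewrite (ord1 j) [RHS]mxE -[LHS](diff_split_familyD M Oo O0 sF sG DG0
        w i).
    by rewrite diff_coord // [LHS](congr1 (fun v : 'cV_(1 + m) => v (rshift 1 i) 0) dVw) mxE.
  by rewrite -(mulKmx Mu y) h mulmx0.
have dDelta : differentiable Delta 0 by exact: (smooth_on_detDxV Oo sV [::]).
apply/eqP => De0; apply: dDw.
rewrite -[LHS]/('d Delta 0 w) wE wy.
have -> : pt (w.1 (lshift m 0) 0) 0 w.2 = w.1 (lshift m 0) 0 *: u_dir R m + w.2 *: (0, 1).
  have -> : (0, 1) = pt 0 0 1 :> 'cV[R]_(1 + m) * R by congr (_, _); rewrite raddf0 col_mx0.
  by rewrite u_dirE !ptZ ptD !mulr0 !mulr1 !scaler0 !addr0 add0r.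
by rewrite linearD !linearZ /= -!deriveE // -/Du -/De Du0 De0 !scaler0 addr0.
Qed.

Section Branch.
Variables (g : R -> R -> 'cV[R]_m) (r : R).
Hypotheses (r_gt0 : 0 < r) (gP : implicit_branch M G g r)
  (rO : forall z, `|z| <= r -> Omega z).
Local Notation f := (reduced F g).

Definition strip (K : R) : set 'cV[R]_(1 + m) :=
  [set x : 'cV[R]_(1 + m) | `|x (lshift m 0) 0| < K /\ `|dsubmx x| <= r].

Lemma strip_nbhs K : 0 < K -> nbhs (0 : 'cV[R]_(1 + m)) (strip K).
Proof.
move=> K0; apply/(@nbhs_norm0P R 'cV[R]_(1 + m) (strip K)); exists (Num.min K r);
    first by rewrite /= lt_min K0.
move=> x /=; rewrite lt_min => /andP[xK xr]; split.
  exact: le_lt_trans (normr_cV_coord _ _) xK.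
by apply: normr_cV_le => [|i]; rewrite ?(ltW r_gt0) // mxE (le_trans (normr_cV_coord _ _)) // ltW.
Qed.

(** Zeros of V in the strip lie on the branch, so they are parametrised by the
    zeros u of the reduced function. *)
Lemma zeros_in_strip K e s : K <= r -> `|e| <= r -> zero_list (f^~ e) K s ->
  (zeros_in V (strip K) e #= `I_(size s))%card.
Proof.
move=> Kr er [us sP].
pose h i : 'cV[R]_(1 + m) := (branch_pt g (nth 0 s i) e).1.
have hu i : h i (lshift m 0) 0 = nth 0 s i by rewrite /h /= col_mxEu mxE mulr1n.
have -> : zeros_in V (strip K) e = h @` `I_(size s).
  apply/seteqP; split => [x [[xK xr] Vx]|x [i /= si <-]].
    have xE := ptE (x, e); rewrite /= in xE.
    set u := x (lshift m 0) 0 in xE xK; set y := dsubmx x in xE xr.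
    have ur := le_trans (ltW xK) Kr.
    have yg : y = g u e.
      by apply: (@zero_on_branch _ _ M F G g r gP u y e ur er xr); rewrite -xE.
    have fu : f u e = 0.
      by apply/(branch_zero F gP ur er); rewrite /branch_pt -yg -xE.
    have us' : u \in s by apply/sP.
    exists (index u s); first by rewrite /= index_mem.
    by rewrite /h nth_index // /branch_pt -yg -xE.
  have [iK fi] : `|nth 0 s i| < K /\ f (nth 0 s i) e = 0 by apply/sP; exact: mem_nth.
  have ir := le_trans (ltW iK) Kr.
  split; first split.
  - by rewrite hu.
  - by rewrite /h /= col_mxKd; have [gS _ _] := gP; have [] := gS _ _ ir er.
  - by rewrite -[(h i, e)]/(branch_pt g (nth 0 s i) e); apply/(branch_zero F gP ir er).
apply: inj_card_eq => i j; rewrite !inE => /= si sj hij.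
by apply/eqP; rewrite -(nth_uniq 0 si sj us) -!hu hij.
Qed.

(** With f_u = a e + b u^2 + o(u^2 + |e|) and k = - b / a, the function
    (3 / b) f(u, k e) has the normalised slope 3 (u^2 - e).  Multiplication by k
    preserves or reverses the direction of the parameter. *)
Lemma pitchfork_at_origin : Du = 0 -> De != 0 -> beta != 0 ->
  bifurcation_1_3 Omega V 0 0 \/ bifurcation_3_1 Omega V 0 0.
Proof.
move=> Du0 De0 beta0.
have dM : \det M != 0 by rewrite -unitfE -unitmxE.
pose a := De / \det M; pose b := beta / (2 * \det M); pose k := - (b / a).
have a0 : a != 0 by rewrite mulf_neq0 ?invr_neq0.
have b0 : b != 0 by rewrite mulf_neq0 ?invr_neq0 ?mulf_neq0 // pnatr_eq0.
have k0 : k != 0 by rewrite oppr_eq0 mulf_neq0 ?invr_neq0.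
have kp : 0 < `|k| by rewrite normr_gt0.
pose df u e := Delta (branch_pt g u e) / uu_cofactor M F G (branch_pt g u e).
pose f2 u e := 3 / b * f u (k * e).
pose df2 u e := 3 / b * df u (k * e).
have [C [C0 [rho1 rho10 H1]]] := quadratic_at_axis Oo O0 sG Mu G0 DG0 r_gt0 gP sF F0 DF0.
have [rho2 rho20 H2] := uu_cofactor_near Oo O0 sF sG Mu DF0 G0 DG0 r_gt0 gP ltr01.
have kball (rho e : R) : `|e| < rho / `|k| -> `|k * e| < rho.
  by rewrite ltr_pdivlMr // normrM mulrC.
pose r1 := Num.min (Num.min r rho1) rho2.
have r10 : 0 < r1 by rewrite !lt_min r_gt0 rho10.
have r1E x : `|x| < r1 -> [/\ `|x| < r, `|x| < rho1 & `|x| < rho2].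
  by rewrite !lt_min => /andP[/andP[? ?] ?].
pose r2 := Num.min r1 (r1 / `|k|).
have r20 : 0 < r2 by rewrite lt_min r10 divr_gt0.
have r2E x : `|x| < r2 -> `|x| < r1 /\ `|x| < r1 / `|k| by rewrite lt_min => /andP[].
have C'0 : 0 < `|3 / b| * (C * k ^+ 2) + 1.
  by rewrite ltr_wpDl // mulr_ge0 // mulr_ge0 ?sqr_ge0 // ltW.
have [||||K [delta [/andP[K0 Kr] /andP[delta0 deltar] one three]]] :=
  @pitchfork_zeros R f2 df2 (`|3 / b| * (C * k ^+ 2) + 1) r2 C'0 r20 _ _ _ (Num.min r (r /
      `|k|)) _.
- move=> u e /r2E[/r1E[ur _ u2] _] /r2E[_ /kball/r1E[er _ e2]].
  have [cp _] := H2 u (k * e) u2 e2.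
  have := reduced_derivative Oo sF sG G0 r_gt0 gP rO ur (ltW er).
  have cn0 : uu_cofactor M F G (branch_pt g u (k * e)) != 0 by apply: contraTneq cp => ->;
      rewrite mul0r ltxx.
  by move=> /(_ cn0) D; exact: is_deriveZ.
- move=> e /r2E[_ /kball/r1E[er e1 _]].
  rewrite normrM [X in _ <= X]mulrDl mul1r.
  apply: (@le_trans _ _ (`|3 / b| * (C * k ^+ 2) * e ^+ 2)); last by rewrite lerDl sqr_ge0.
  by rewrite -mulrA ler_wpM2l // -mulrA -exprMn; exact: H1.
- move=> eta eta0.
  have eta'0 : 0 < eta / (`|3 / b| * (1 + `|k|)).
    by rewrite divr_gt0 // mulr_gt0 ?normr_gt0 ?mulf_neq0 ?invr_neq0 ?pnatr_eq0 // ltr_wpDr.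
  have [rho rho0 H] := slope_expansion Oo O0 sF sG Mu DF0 G0 DG0 r_gt0 gP Du0 eta'0.
  exists (Num.min rho (rho / `|k|)); first by rewrite lt_min rho0 divr_gt0.
  move=> u e; rewrite !lt_min => /andP[ur _] /andP[_ /kball er].
  have := H u (k * e) ur er; rewrite -/Delta -/(df u (k * e)) -/De -/beta -/a -/b => h.
  have -> : df2 u e - 3 * (u ^+ 2 - e) = 3 / b * (df u (k * e) - (a * (k * e) + b * u ^+ 2)).
    by rewrite /df2 /k; field; rewrite ?a0 ?b0.
  rewrite normrM.
  apply: (@le_trans _ _ (`|3 / b| * (eta / (`|3 / b| * (1 + `|k|)) * (u ^+ 2 + `|k * e|)))).
    by rewrite ler_wpM2l.
  have n3 : `|3 / b| != 0 by rewrite normr_eq0 mulf_neq0 ?invr_neq0 ?pnatr_eq0.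
  have n1 : 1 + `|k| != 0 by rewrite gt_eqF // ltr_wpDr.
  have -> : `|3 / b| * (eta / (`|3 / b| * (1 + `|k|)) * (u ^+ 2 + `|k * e|)) =
    eta * ((u ^+ 2 + `|k| * `|e|) / (1 + `|k|)).
    by rewrite (normrM k e); move: `|3 / b| n3 => q n3; field; rewrite ?n3 ?n1.
  rewrite ler_wpM2l ?(ltW eta0) // ler_pdivrMr ?ltr_wpDr //.
  have := sqr_ge0 u; have : 0 <= `|e| by []; have :
      0 <= `|k| * u ^+ 2 by rewrite mulr_ge0 ?sqr_ge0.
  by lra.
- by rewrite lt_min r_gt0 divr_gt0.
have zl e e' s : e = k * e' -> zero_list (f2^~ e') K s -> zero_list (f^~ e) K s.
  move=> -> [us sP]; split => // u; rewrite -sP /f2; split => -[uK fu]; split => //.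
    by rewrite fu mulr0.
  by move/eqP: fu; rewrite mulf_eq0 (negPf (mulf_neq0 _ _)) ?invr_neq0 ?pnatr_eq0 //= => /eqP.
move: Kr deltar; rewrite !lt_min => /andP[Kr _] /andP[_]; rewrite ltr_pdivlMr // => deltar.
pose d := delta * `|k|; have d0 : 0 < d by rewrite mulr_gt0.
have inO x e : strip K x -> 0 - d < e < 0 + d -> Omega (x, e).
  move=> [xK xr]; rewrite sub0r add0r -ltr_norml => ed; apply: rO.
  rewrite (ptE (x, e)) norm_pt_le /= xr (le_trans (ltW xK)) ?(ltW Kr) //=.
  by rewrite (le_trans (ltW ed)) // ltW.
have eR e : - d < e < d -> `|e| <= r.
  by rewrite -ltr_norml => ed; rewrite (le_trans (ltW ed)) // ltW.
have card1 e : - delta < e / k <= 0 -> - d < e < d -> (zeros_in V (strip K) e #= `I_1)%card.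
  move=> /one[s zs sz] /eR er.
  have zs' : zero_list (f^~ e) K s by apply: zl zs; rewrite mulrC divfK.
  by have := zeros_in_strip (ltW Kr) er zs'; rewrite sz.
have card3 e : 0 < e / k < delta -> - d < e < d -> (zeros_in V (strip K) e #= `I_3)%card.
  move=> /three[s zs sz] /eR er.
  have zs' : zero_list (f^~ e) K s by apply: zl zs; rewrite mulrC divfK.
  by have := zeros_in_strip (ltW Kr) er zs'; rewrite sz.
case: (ltgtP k 0) k0 => // [kn|kpos] _; [right|left]; exists (strip K), d.
  have dE : d = - (delta * k) by rewrite /d ltr0_norm // mulrN.
  split => //; first exact: strip_nbhs.
    move=> e; rewrite sub0r => /andP[e1 e2]; apply: card3; last by rewrite e1 (lt_trans e2).
    by rewrite ltr_ndivlMr // ltr_ndivrMr // mul0r e2 /=; move: e1; rewrite dE opprK.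
  move=> e; rewrite add0r => /andP[e1 e2]; apply: card1;
      last by rewrite e2 andbT (lt_le_trans _ e1) // oppr_lt0.
  by rewrite ltr_ndivlMr // ler_ndivrMr // mul0r e1 mulNr andbT -dE.
have dE : d = delta * k by rewrite /d gtr0_norm.
split => //; first exact: strip_nbhs.
  move=> e; rewrite sub0r => /andP[e1 e2]; apply: card1; last by rewrite e1 (le_lt_trans e2).
  by rewrite ltr_pdivlMr // ler_pdivrMr // mul0r e2 mulNr andbT -dE.
move=> e; rewrite add0r => /andP[e1 e2]; apply: card3;
    last by rewrite e2 andbT (lt_trans _ e1) // oppr_lt0.
by rewrite ltr_pdivlMr // ltr_pdivrMr // mul0r e1 /= -dE.
Qed.

End Branch.
End Assembly.

Theorem theorem1p3 (R : realType) (m : nat) (M : 'M[R]_m)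
    (Omega : set ('cV[R]_(1 + m) * R))
    (F : 'cV[R]_(1 + m) * R -> R)
    (G : 'cV[R]_(1 + m) * R -> 'cV[R]_m)
    (Omega_open : open Omega) (Omega0 : Omega 0)
    (F_smooth : smooth_on Omega F) (G_smooth : smooth_on Omega G)
    (M_hyperbolic : hyperbolic_mx M)
    (F0 : F 0 = 0) (DF0 : forall w, 'd F 0 w = 0)
    (G0 : G 0 = 0) (DG0 : forall w, 'd G 0 w = 0)
    (P0 : propertyP0 Omega (split_family M F G) 0 0)
    (P1 : propertyP1 (split_family M F G) 0 0)
    (P2 : propertyP2 (split_family M F G) 0 0)
    (P3 : propertyP3 M F G) :
  bifurcation_1_3 Omega (split_family M F G) 0 0 \/
  bifurcation_3_1 Omega (split_family M F G) 0 0.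
Proof.
have Mu := hyperbolic_unitmx M_hyperbolic.
have [rho rho0 rhoO] : exists2 rho : R, 0 < rho & forall z, `|z| < rho -> Omega z.
  by apply: near0_radius; exact: open_nbhs_nbhs.
have [g [r /andP[r0 rrho] gP]] := implicit_branch_exists Omega_open Omega0 G_smooth Mu G0 DG0
    rho0.
have rO z : `|z| <= r -> Omega z by move=> zr; apply: rhoO; apply: le_lt_trans rrho.
have [_ _ [d idx d0]] := P0.
have Du0 := index_forces_Du0 Omega_open Omega0 F_smooth G_smooth Mu F0 DF0 G0 DG0 r0 gP rO idx d0.
apply: (pitchfork_at_origin Omega_open Omega0 F_smooth G_smooth Mu F0 DF0 G0 DG0 r0 gP rO Du0).
  exact: (transversality Omega_open Omega0 F_smooth G_smooth Mu DG0 Du0 P2).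
by apply/eqP; exact: P3.
Qed.
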